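(* Let $B$ be a simple properly ordered Bratteli diagram (with $X_B$ a Cantor set). Then there is a diagram $B'$, obtained by telescoping $B$, which admits an extension triple $(B',\hat B,\pi)$ such that $\pi\colon(X_{\hat B},\phi_{\hat B})\to(X_{B'},\phi_{B'})$ is an irregular almost $1$-to-$1$ factor map all of whose fibres have at most $2$ elements. If, additionally, $(X_B,\phi_B)$ is $k$-expansive (for some $k\ge0$), then $\hat B$ can be chosen such that also $(X_{\hat B},\phi_{\hat B})$ is $k$-expansive.
   Context: **Bratteli diagrams.** A Bratteli diagram $B=(V,E)$ is an infinite graph with vertices $V=\bigsqcup_{n\ge0}V_n$, $V_0=\{v_0\}$, $1\le|V_n|<\infty$, edges $E=\bigsqcup_{n\ge0}E_n$, $1\le|E_n|<\infty$, and range and source maps $r,s\colon E\to V$ with $r(E_n)=V_{n+1}$, $s(E_n)=V_n$. A path is a (finite or infinite) sequence of edges $(e_0,e_1,\ldots)$ with $r(e_{i-1})=s(e_i)$. $E_{n,N}$ is the set of finite paths from $V_n$ to $V_N$. $X_B$ is the set of infinite paths $(\alpha_0,\alpha_1,\ldots)$ ($\alpha_n\in E_n$) starting in $v_0$; the $n$-head of such a path is $(\alpha_0,\ldots,\alpha_n)$, and $X_B$ carries the topology generated by the cylinders $[e_0,\ldots,e_n]$ (all paths in $X_B$ with $n$-head $(e_0,\ldots,e_n)$). Telescoping $B$ along $0=n_0<n_1<\cdots$ gives the diagram with vertex sets $V_{n_k}$ and edge sets $E_{n_k,n_{k+1}}$. $B$ is simple if it can be telescoped to a diagram in which each vertex of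 each level is connected by an edge to each vertex of the next level. **Orders.** $B$ is ordered if $E$ carries a partial order in which $e,e'$ are comparable iff $r(e)=r(e')$. This extends to finite paths starting on the same level and ending in the same vertex, and to infinite paths which eventually agree, by comparing the edges on the last level where the paths differ; telescoped diagrams inherit the order. A path is maximal (minimal) if all its edges are. $B$ is properly ordered if $X_B$ has a unique maximal path $\gamma^+$ and a unique minimal path $\gamma^-$. The Vershik map $\phi_B\colon X_B\to X_B$ sends each non-maximal path to its successor and $\gamma^+$ to $\gamma^-$; it is a homeomorphism. All diagrams $B,B',\hat B$ are assumed to be simple, properly ordered, with path space a Cantor set. **Copy-pasting and extension triples.** Write $V_n=\{v_0(n),\ldots,v_{|V_n|-1}(n)\}$, let $r_\ell(n)$ be the number of $e\in E_n$ with range $v_\ell(n+1)$, and let $e_{\ell,0}(n)<e_{\ell,1}(n)<\cdots<e_{\ell,r_\ell(n)-1}(n)$ be these edges. $\hat B=(\hat V,\hat E,\hat\le)$ is obtained by copy-pasting $B$ if (possibly after relabelling) $\hat V_0=\{v_0\}$ and: (i) for $n\ge1$ there are $j_\ell(n)\in\mathbb N$ with $\hat V_n=\{v_\ell^j(n)\colon 0\le\ell<|V_n|,\ 0\le j<j_\ell(n)\}$; (ii) for $n\ge0$, $\hat E_n=\{e_{\ell,m}^j(n)\colon 0\le\ell<|V_{n+1}|,\ 0\le m<r_\ell(n),\ 0\le j<j_\ell(n+1)\}$ with $r(e_{\ell,m}^j(n))=v_\ell^j(n+1)$; (iii) for $n\ge1$, if $s(e_{\ell,m}(n))=v_{\ell'}(n)$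 in $B$, then $s(e_{\ell,m}^j(n))=v_{\ell'}^{j'}(n)$ for some $j'$; (iv) $e_{\ell,m}^j(n)\,\hat<\,e_{\ell',m'}^{j'}(n')$ iff $j=j'$ and $e_{\ell,m}(n)<e_{\ell',m'}(n')$ in $B$. The collapsing map $\pi\colon X_{\hat B}\to X_B$, $(e_{\ell_n,m_n}^{j_n}(n))_{n\ge0}\mapsto(e_{\ell_n,m_n}(n))_{n\ge0}$ is an (almost $1$-to-$1$) factor map, i.e. a continuous surjection with $\pi\circ\phi_{\hat B}=\phi_B\circ\pi$; $(B,\hat B,\pi)$ is called an extension triple. **Irregularity.** A fibre $\pi^{-1}\alpha$ is regular if it is a singleton. $\pi$ is almost $1$-to-$1$ if it has at least one regular fibre. It is irregular if, for every invariant Borel probability measure $\mu$ of the factor system, the set of $\alpha$ over which the fibre is regular has $\mu$-measure $0$. **$k$-expansive.** $(X_B,\phi_B)$ is $k$-expansive if for all $\gamma\ne\gamma'$ in $X_B$ there is $n\in\mathbb Z$ such that the $k$-heads of $\phi_B^n(\gamma)$ and $\phi_B^n(\gamma')$ differ. *)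

(* Defs.v *)
From HB Require Import structures.
From mathcomp Require Import all_boot all_order all_algebra.
From mathcomp Require Import all_classical all_reals all_analysis.

Set Implicit Arguments.
Unset Strict Implicit.
Unset Printing Implicit Defensive.

Local Open Scope classical_set_scope.

(* Ordered Bratteli diagrams. Nonemptiness of every [vtx n] and [edge n]
   follows from [vtx0] and the surjectivity of the source and range maps.  The
   partial order on the disjoint union of the [edge n] is given level by level,
   since edges of different levels have different ranges, so are never
   comparable. *)
Record bratteli := Bratteli {
  vtx : nat -> finType;
  edge : nat -> finType;
  src : forall n, edge n -> vtx n;
  rng : forall n, edge n -> vtx n.+1;
  ele : forall n, rel (edge n);
  vtx0 : #|vtx 0| = 1;
  src_surj : forall n (v : vtx n), exists e, src e == v;
  rng_surj : forall n (v : vtx n.+1), exists e, rng e == v;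
  ele_refl : forall n, reflexive (@ele n);
  ele_anti : forall n, antisymmetric (@ele n);
  ele_trans : forall n, transitive (@ele n);
  ele_comparable : forall n (e e' : edge n),
    ele e e' || ele e' e = (rng e == rng e')
}.

Definition elt (B : bratteli) n (e e' : edge B n) := (e != e') && ele e e'.

(* Finite paths with [m.+1] edges starting on level [n], i.e. the elements of
   E_{n, m.+1 + n}; the [i]-th edge lies in E_(i + n).  With this orientation
   of the sum, all the levels below agree by computation. *)
Definition fpath (B : bratteli) (n m : nat) : finType :=
  {p : {dffun forall i : 'I_m.+1, edge B (i + n)} |
    [forall i : 'I_m,
      src (p (lift ord0 i)) == rng (p (widen_ord (leqnSn m) i))]}.

Definition fpath_src B n m (p : fpath B n m) : vtx B n :=
  src (val p ord0).

Definition fpath_rng B n m (p : fpath B n m) : vtx B (m.+1 + n) :=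
  rng (val p ord_max).

Definition fpath_le B n m : rel (fpath B n m) := fun p q =>
  (p == q) ||
  [exists i : 'I_m.+1, elt (val p i) (val q i) &&
             [forall j : 'I_m.+1, (i < j)%N ==> (val p j == val q j)]].

Section FinitePaths.
Variable B : bratteli.

Lemma elt_rng n (e e' : edge B n) : elt e e' -> rng e = rng e'.
Proof.
by case/andP=> _ le_ee'; apply/eqP; rewrite -ele_comparable le_ee'.
Qed.

Lemma elt_trans n : transitive (@elt B n).
Proof.
move=> y x z /andP[nxy xy] /andP[nyz yz]; rewrite /elt (ele_trans xy yz) andbT.
by apply: contraNneq nxy => xz; apply/eqP/ele_anti; rewrite xy xz yz.
Qed.

Lemma elt_irr n (e : edge B n) : elt e e = false.
Proof. by rewrite /elt eqxx. Qed.

Lemma elt_total n (e e' : edge B n) :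
  e != e' -> rng e = rng e' -> elt e e' || elt e' e.
Proof.
move=> ne /eqP; rewrite -ele_comparable /elt ne eq_sym ne; exact.
Qed.

Definition fpath_of n m (x : forall i, edge B (i + n))
    (xP : forall i, (i < m)%N -> src (x i.+1) = rng (x i)) : fpath B n m.
Proof.
exists [ffun i : 'I_m.+1 => x i].
by apply/forallP => i; rewrite !ffunE /=; apply/eqP/xP.
Defined.

Fixpoint forward n (v : vtx B n) i : edge B (i + n) :=
  match i with
  | 0 => xchoose (src_surj v)
  | i'.+1 => xchoose (src_surj (rng (forward v i')))
  end.

Lemma forwardP n (v : vtx B n) i : src (forward v i.+1) = rng (forward v i).
Proof. exact/eqP/(xchooseP (src_surj (rng (forward v i)))). Qed.

Lemma fpath_src_surj n m (v : vtx B n) :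
  exists p : fpath B n m, fpath_src p == v.
Proof.
exists (fpath_of (fun i (_ : (i < m)%N) => forwardP v i)).
rewrite /fpath_src /= ffunE /=; exact: (xchooseP (src_surj v)).
Qed.

Lemma backward n m (v : vtx B (m + n).+1) :
  exists2 x : forall i, edge B (i + n),
    rng (x m) = v & forall i, (i < m)%N -> src (x i.+1) = rng (x i).
Proof.
pose T i : Type := edge B (i + n).
elim: m v => [|m IHm] v; have [e /eqP re] := rng_surj v.
  by exists (@eqtype.dfwith _ T (forward (src e)) 0 e) => //; rewrite (@eqtype.dfwith_in _ T).
have [x rx xP] := IHm (src e).
exists (@eqtype.dfwith _ T x m.+1 e); first by rewrite (@eqtype.dfwith_in _ T).
move=> i; rewrite ltnS leq_eqVlt => /predU1P[->|ltim].
  by rewrite (@eqtype.dfwith_in _ T) (@eqtype.dfwith_out _ T) ?gtn_eqF ?rx.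
by rewrite !(@eqtype.dfwith_out _ T) ?xP// gtn_eqF// ltnS ltnW.
Qed.

Lemma fpath_rng_surj n m (v : vtx B (m.+1 + n)) :
  exists p : fpath B n m, fpath_rng p == v.
Proof.
have [x rx xP] := backward (v : vtx B (m + n).+1).
by exists (fpath_of xP); rewrite /fpath_rng /= ffunE /= -rx.
Qed.

Lemma fpath_ltP n m (p q : fpath B n m) :
  reflect (exists2 i, elt (val p i) (val q i) &
             forall j : 'I_m.+1, (i < j)%N -> val p j = val q j)
    [exists i : 'I_m.+1, elt (val p i) (val q i) &&
             [forall j : 'I_m.+1, (i < j)%N ==> (val p j == val q j)]].
Proof.
apply: (iffP existsP) => [[i /andP[lti /forallP eqj]]|[i lti eqj]]; exists i => //.
  by move=> j ltij; apply/eqP; move: (eqj j); rewrite ltij.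
by rewrite lti; apply/forallP => j; apply/implyP => /eqj ->.
Qed.

Lemma fpath_le_refl n m : reflexive (@fpath_le B n m).
Proof. by move=> p; rewrite /fpath_le eqxx. Qed.

Lemma fpath_le_trans n m : transitive (@fpath_le B n m).
Proof.
move=> q p r /predU1P[->//|/fpath_ltP[i lti eqi]].
move=> /predU1P[<-|/fpath_ltP[j ltj eqj]].
  by apply/orP; right; apply/fpath_ltP; exists i.
apply/orP; right; apply/fpath_ltP.
case: (ltngtP i j) => ij.
- by exists j => [|k jk]; [rewrite eqi | rewrite eqi ?eqj// (ltn_trans ij)].
- by exists i => [|k ik]; [rewrite -eqj | rewrite eqi// eqj// (ltn_trans ij)].
- move/val_inj: ij => ij; subst j.
  by exists i => [|k ik]; [apply: elt_trans lti ltj | rewrite eqi// eqj].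
Qed.

Lemma fpath_le_anti n m : antisymmetric (@fpath_le B n m).
Proof.
move=> p q /andP[/predU1P[//|/fpath_ltP[i lti eqi]]].
move=> /predU1P[//|/fpath_ltP[j ltj eqj]].
case: (ltngtP i j) => ij.
- by move: ltj; rewrite eqi// elt_irr.
- by move: lti; rewrite -eqj// elt_irr.
- move/val_inj: ij => ij; subst j.
  by have := elt_trans lti ltj; rewrite elt_irr.
Qed.

Lemma fpath_le_comparable n m (p q : fpath B n m) :
  fpath_le p q || fpath_le q p = (fpath_rng p == fpath_rng q).
Proof.
apply/idP/eqP => [|eqr].
  suff rngE (p' q' : fpath B n m) :
    fpath_le p' q' -> fpath_rng p' = fpath_rng q'.
    by case/orP => /rngE.
  move=> /predU1P[->//|/fpath_ltP[i lti eqi]]; rewrite /fpath_rng.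
  have [ltim|] := boolP (i < @ord_max m)%N; first by rewrite eqi.
  rewrite -leqNgt => leim.
  have iE : i = ord_max by apply/val_inj/anti_leq; rewrite leim /= leq_ord.
  by move: lti; rewrite iE => /elt_rng.
have [->|npq] := eqVneq p q; first by rewrite fpath_le_refl.
have [i0 nei0] : exists i, val p i != val q i.
  apply/existsP; apply: contraNT npq; rewrite negb_exists => /forallP eqpq.
  by apply/eqP/val_inj/ffunP => i; apply/eqP; rewrite -[_ == _]negbK.
have [i nei maxi] := @arg_maxnP _ i0 (fun i => val p i != val q i) val nei0.
have eqi (j : 'I_m.+1) : (i < j)%N -> val p j = val q j.
  move=> ltij; apply/eqP; apply: contraLR ltij => /maxi.
  by rewrite -leqNgt.
have rngi : rng (val p i) = rng (val q i).
  have [ltim|leim] := ltnP i m; last first.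
    have -> : i = ord_max by apply/val_inj/anti_leq; rewrite leim /= leq_ord.
    exact: eqr.
  have -> : i = widen_ord (leqnSn m) (Ordinal ltim) by apply/val_inj.
  have /forallP/(_ (Ordinal ltim))/eqP <- := valP p.
  have /forallP/(_ (Ordinal ltim))/eqP <- := valP q.
  by rewrite eqi.
case/orP: (elt_total nei rngi) => lti.
  by apply/orP; left; apply/orP; right; apply/fpath_ltP; exists i.
by apply/orP; right; apply/orP; right; apply/fpath_ltP; exists i => // j /eqi.
Qed.

End FinitePaths.

(* A sequence 0 = n_0 < n_1 < ... is encoded by an arbitrary sequence [d] of
   naturals, with n_(k+1) = n_k + d_k + 1. *)
Fixpoint tlevel (d : nat -> nat) (k : nat) : nat :=
  match k with
  | 0 => 0
  | k'.+1 => (d k').+1 + tlevel d k'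
  end.

Definition telescoping (B : bratteli) (d : nat -> nat) : bratteli :=
  @Bratteli (fun k => vtx B (tlevel d k)) (fun k => fpath B (tlevel d k) (d k))
    (fun k p => fpath_src p) (fun k p => fpath_rng p)
    (fun k => @fpath_le B (tlevel d k) (d k))
    (vtx0 B)
    (fun k v => fpath_src_surj (d k) v)
    (fun k v => fpath_rng_surj v)
    (fun k => @fpath_le_refl B _ _) (fun k => @fpath_le_anti B _ _)
    (fun k => @fpath_le_trans B _ _) (fun k => @fpath_le_comparable B _ _).

Definition simple_diagram (B : bratteli) : Prop :=
  exists d : nat -> nat,
    forall n (v : vtx (telescoping B d) n) (w : vtx (telescoping B d) n.+1),
      exists e : edge (telescoping B d) n, src e = v /\ rng e = w.

(* The path space X_B, with the topology generated by the cylinders. *)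
Record ipath (B : bratteli) := IPath {
  edge_at :> forall n, edge B n;
  ipathP : forall n, src (edge_at n.+1) = rng (edge_at n)
}.

Definition same_head (B : bratteli) (k : nat) (x y : ipath B) : Prop :=
  forall i, (i <= k)%N -> x i = y i.

Fixpoint some_edges (B : bratteli) (v : vtx B 0) (n : nat) : edge B n :=
  match n with
  | 0 => xchoose (src_surj v)
  | n'.+1 => xchoose (src_surj (rng (some_edges v n')))
  end.

Lemma some_edgesP (B : bratteli) (v : vtx B 0) (n : nat) :
  src (some_edges v n.+1) = rng (some_edges v n).
Proof. exact/eqP/(xchooseP (src_surj (rng (some_edges v n)))). Qed.

Lemma root_exists (B : bratteli) : exists v : vtx B 0, true.
Proof.
have /card_gt0P[v _] : (0 < #|vtx B 0|)%N by rewrite vtx0.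
by exists v.
Qed.

HB.instance Definition _ (B : bratteli) := gen_eqMixin (ipath B).
HB.instance Definition _ (B : bratteli) := gen_choiceMixin (ipath B).
HB.instance Definition _ (B : bratteli) :=
  isPointed.Build (ipath B) (IPath (some_edgesP (xchoose (root_exists B)))).

(* The pair [(x, n)] indexes the cylinder given by the [n]-head of [x]. *)
Definition cylinder (B : bratteli) (c : ipath B * nat) : set (ipath B) :=
  [set y | same_head c.2 c.1 y].

HB.instance Definition _ (B : bratteli) :=
  @isSubBaseTopological.Build (ipath B) (ipath B * nat)%type setT (@cylinder B).

Definition ipath_lt (B : bratteli) (x y : ipath B) : Prop :=
  exists n, elt (x n) (y n) /\ forall m, (n < m)%N -> x m = y m.

Definition maximal_path (B : bratteli) (x : ipath B) : Prop :=
  forall n (e : edge B n), ~~ elt (x n) e.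

Definition minimal_path (B : bratteli) (x : ipath B) : Prop :=
  forall n (e : edge B n), ~~ elt e (x n).

Definition properly_ordered (B : bratteli) : Prop :=
  (exists! x : ipath B, maximal_path x) /\
  (exists! x : ipath B, minimal_path x).

Definition is_successor (B : bratteli) (x y : ipath B) : Prop :=
  ipath_lt x y /\ forall z, ~ (ipath_lt x z /\ ipath_lt z y).

(* For properly ordered diagrams the set below is a singleton. *)
Definition vershik (B : bratteli) (x : ipath B) : ipath B :=
  xget x [set y | (maximal_path x -> minimal_path y) /\
                  (~ maximal_path x -> is_successor x y)].

(* Inverse of the Vershik map, which is bijective on properly ordered
   diagrams. *)
Definition vershik_inv (B : bratteli) (x : ipath B) : ipath B :=
  xget x [set y | vershik y = x].

Definition vershik_iter (B : bratteli) (n : int) (x : ipath B) : ipath B :=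
  match n with
  | Posz m => iter m (@vershik B) x
  | Negz m => iter m.+1 (@vershik_inv B) x
  end.

Definition k_expansive (k : nat) (B : bratteli) : Prop :=
  forall x y : ipath B, x <> y ->
    exists n : int, ~ same_head k (vershik_iter n x) (vershik_iter n y).

(* [cantor_like] is compact, Hausdorff, perfect and zero-dimensional;
   metrizability is automatic here as there are countably many cylinders. *)
Definition admissible (B : bratteli) : Prop :=
  [/\ simple_diagram B, properly_ordered B & cantor_like (ipath B)].

(* [B'] is obtained by copy-pasting [B]. The number of copies of a vertex [v]
   of level [n.+1] is [copies n v]. The bijections [vlabel] and [elabel] express
   the relabelling: a vertex of [B'] with label (v, j) is the j-th copy of v,
   and an edge with label (e, j) is the j-th copy of e, whose range is the j-th
   copy of the range of e. *)
Record copy_pasting (B B' : bratteli) := CopyPasting {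
  copies : forall n, vtx B n.+1 -> nat;
  vlabel : forall n, vtx B' n.+1 -> {v : vtx B n.+1 & 'I_(copies v)};
  elabel : forall n, edge B' n -> {e : edge B n & 'I_(copies (rng e))};
  vlabel_bij : forall n, bijective (@vlabel n);
  elabel_bij : forall n, bijective (@elabel n);
  elabel_rng : forall n (e : edge B' n),
    vlabel (rng e) = existT _ (rng (tag (elabel e))) (tagged (elabel e));
  elabel_src : forall n (e : edge B' n.+1),
    tag (vlabel (src e)) = src (tag (elabel e));
  elabel_lt : forall n (e e' : edge B' n),
    elt e e' =
      (tagged (elabel e) == tagged (elabel e') :> nat) &&
      elt (tag (elabel e)) (tag (elabel e'))
}.

Section Collapse.
Variables (B B' : bratteli) (C : copy_pasting B B').

Lemma collapse_subproof (x : ipath B') n :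
  src (tag (elabel C (x n.+1))) = rng (tag (elabel C (x n))).
Proof. by rewrite -elabel_src ipathP elabel_rng. Qed.

Definition collapse (x : ipath B') : ipath B := IPath (collapse_subproof x).

End Collapse.

Definition extension_triple (B B' : bratteli) (p : ipath B' -> ipath B) : Prop :=
  [/\ admissible B, admissible B' &
      exists C : copy_pasting B B', p = collapse C].

Section FactorMaps.
Variables (B B' : bratteli) (p : ipath B' -> ipath B).

Definition factor_map : Prop :=
  [/\ continuous p, forall a, exists x, p x = a &
      forall x, p (vershik x) = vershik (p x)].

Definition regular_fibre (a : ipath B) : Prop :=
  exists x, p @^-1` [set a] = [set x].

Definition almost_one_to_one : Prop := exists a, regular_fibre a.

Definition borel_ipath := g_sigma_algebraType (@open (ipath B)).

Definition invariant_measure (R : realType) (mu : probability borel_ipath R) :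
    Prop :=
  forall A : set borel_ipath, measurable A ->
    mu (@vershik B @^-1` A) = mu A.

Definition irregular (R : realType) : Prop :=
  forall mu : probability borel_ipath R, invariant_measure mu ->
    mu.-negligible [set a : borel_ipath | regular_fibre a].

Definition fibres_le2 : Prop :=
  forall a : ipath B, (p @^-1` [set a] #<= `I_2)%card.

End FactorMaps.

(* Main.v *)
Require Import Defs.
From mathcomp Require Import all_boot all_order all_algebra.
From mathcomp Require Import finmap.
From mathcomp Require Import all_classical all_reals all_analysis.

(** Telescope [B] so that any two vertices of levels [n] and [n.+1] are joined by
    at least [2 ^ n.+2] edges ([multiplying_telescoping]); this is possible since
    [B] is simple and no path is isolated. Call an edge extremal if it is maximal
    or minimal among the edges with its range. In the extension, every vertex
    but the root is doubled, so that a point over a path [a] is a labelling of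
    [a] by booleans, and the edge [a n.+1] determines the label of level [n]
    from that of level [n.+1] by a map [twist] of the booleans: it is constant
    for extremal edges, and either the identity or the negation for the others,
    both kinds occurring between any two vertices.

    Fibres are thus inverse limits of sets with two elements. They have at most
    two points, exactly two if [a] has finitely many extremal edges, and one
    point over the maximal and minimal paths; hence the extension is properly
    ordered, and the factor map is almost one-to-one. As both identity and
    negation occur, the doubled diagram is simple.

    For irregularity, let [mu] be invariant. Cylinders that end in the same
    vertex are translates of each other under the Vershik map
    ([cylinder_measure]), so parallel edges carry the same mass
    ([parallel_edge_measure]). As at most two of the edges into a vertex are
    extremal, the paths whose [n]-th edge is extremal have mass at most
    [2 / 2 ^ n.+2], and by Borel-Cantelli almost every path has finitely many
    extremal edges ([ext_edges_null]).

    Expansiveness passes to telescopings, because heads only get longer, and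
    from there to the extension for points in different fibres. Two points of
    one fibre have different labels from some level [N] on. A power of the
    Vershik map takes their common image to a path whose edges up to level [N]
    are not extremal, and takes the two points along simultaneously
    ([simultaneous_reach]). Along such edges labels are transported by
    bijections, so that already the edges of level 0 are different. *)

Set Implicit Arguments.
Unset Strict Implicit.
Unset Printing Implicit Defensive.
Import Order.TTheory GRing.Theory Num.Theory.

Local Open Scope classical_set_scope.

(** * Cutting and pasting paths *)

Lemma ipath_ext (B : bratteli) (x y : ipath B) :
  (forall n, x n = y n) -> x = y.
Proof.
case: x y => [x xP] [y yP] /= eqxy.
have eqf : x = y by apply/functional_extensionality_dep => n; exact: eqxy.
subst y; congr IPath; exact: Prop_irrelevance.
Qed.

Lemma ipath_neq (B : bratteli) (x y : ipath B) : x <> y -> exists n, x n <> y n.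
Proof.
move=> nxy; apply: contrapT => none; apply/nxy/ipath_ext => n.
by apply: contrapT => nexy; apply: none; exists n.
Qed.

Section Splice.
Variable B : bratteli.
Implicit Types x y : ipath B.

Lemma splice_path n x y : src (y n.+1) = rng (x n) ->
  forall i, src (if (i.+1 <= n)%N then x i.+1 else y i.+1) =
            rng (if (i <= n)%N then x i else y i).
Proof.
move=> h i.
case: (ltngtP i n) => [?|?|E]; [exact: ipathP|exact: ipathP|by rewrite E h].
Qed.

(** Total, with value [x] where the two pieces do not fit, so that a tail can be
    attached without carrying a proof. *)
Definition splice n x y : ipath B :=
  if pselect (src (y n.+1) = rng (x n)) is left h
  then IPath (edge_at := fun i => if (i <= n)%N then x i else y i) (splice_path h)
  else x.

Lemma splice_le n x y i : (i <= n)%N -> splice n x y i = x i.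
Proof. by rewrite /splice; case: pselect => //= h ->. Qed.

Lemma splice_gt n x y i :
  src (y n.+1) = rng (x n) -> (n < i)%N -> splice n x y i = y i.
Proof. by rewrite /splice; case: pselect => //= h _; rewrite ltnNge => /negbTE ->. Qed.

End Splice.

(** Paths are built downwards from a given edge [e], choosing at each level an
    edge with property [P] into the vertex reached. The sequence [t] needs to be
    a path only above level [n], which is what makes the induction go through. *)
Lemma graft (B : bratteli) (P : forall n, edge B n -> Prop) :
  (forall n (v : vtx B n.+1), exists2 e, rng e = v & P n e) ->
  forall n (e : edge B n) (t : forall m, edge B m),
  (forall m, (n < m)%N -> src (t m.+1) = rng (t m)) ->
  src (t n.+1) = rng e ->
  exists z : ipath B, [/\ z n = e, forall m, (n < m)%N -> z m = t m &
                          forall i, (i < n)%N -> P i (z i)].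
Proof.
move=> selP; elim=> [|n IHn] e t tP te; pose t' := eqtype.dfwith t e.
  have zP m : src (t' m.+1) = rng (t' m).
    rewrite /t' eqtype.dfwith_out//; case: m => [|m].
      by rewrite eqtype.dfwith_in.
    by rewrite eqtype.dfwith_out// tP.
  exists (IPath zP); split=> //=; rewrite /t'; first by rewrite eqtype.dfwith_in.
  by move=> m m0; rewrite eqtype.dfwith_out// ltn_eqF.
have [e' re' Pe'] := selP n (src e).
have [|| z [zn zt zP]] := IHn e' t'.
- move=> m ltnm; rewrite /t' eqtype.dfwith_out; last by rewrite ltn_eqF.
  have [E|nem] := eqVneq n.+1 m; first by subst m; rewrite eqtype.dfwith_in.
  by rewrite eqtype.dfwith_out// tP// ltn_neqAle nem.
- by rewrite /t' eqtype.dfwith_in re'.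
exists z; split=> [|m ltnm|i].
- by rewrite zt// /t' eqtype.dfwith_in.
- by rewrite zt 1?ltnW// /t' eqtype.dfwith_out// ltn_eqF.
- by rewrite ltnS leq_eqVlt => /predU1P[->|/zP//]; rewrite zn.
Qed.

Lemma through_edge (B : bratteli) n (e : edge B n) :
  exists x : ipath B, x n = e.
Proof.
have [v _] := root_exists B.
(* A path from the root, in which the edge of level [n] is replaced by [e] and
   which is continued arbitrarily from there; it may be broken just below [n]. *)
pose s := fix s m := match m return edge B m with
  | 0 => eqtype.dfwith (some_edges v) e 0
  | m'.+1 => eqtype.dfwith (eqtype.dfwith (some_edges v)
      (xchoose (src_surj (rng (s m'))))) e m'.+1 end.
have sn : s n = e by case: n e @s => [|n] e /=; rewrite eqtype.dfwith_in.
have sP m : (n <= m)%N -> src (s m.+1) = rng (s m).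
  move=> lenm; rewrite [s m.+1]/= eqtype.dfwith_out; last by rewrite ltn_eqF.
  rewrite eqtype.dfwith_in; exact/eqP/(xchooseP (src_surj _)).
have sel k (w : vtx B k.+1) : exists2 e, rng e = w & True.
  by have [f /eqP] := rng_surj w; exists f.
have [||z [zn _ _]] := graft sel (n := n) (e := e) (t := s).
- by move=> m /ltnW /sP.
- by rewrite sP// sn.
- by exists z.
Qed.

Lemma through_vertex (B : bratteli) n (v : vtx B n) :
  exists x : ipath B, src (x n) = v.
Proof.
have [e /eqP ev] := src_surj v.
by have [x xn] := through_edge e; exists x; rewrite xn.
Qed.

(** * Extremal edges and immediate successors *)

(** An element with the largest number of predecessors is maximal. *)
Lemma exists_maximal (T : finType) (R : rel T) (A : {pred T}) x0 :
  transitive R -> irreflexive R -> x0 \in A ->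
  exists2 m, m \in A & forall y, y \in A -> ~~ R m y.
Proof.
move=> Rtr Rirr Ax0.
have [m Am maxm] := arg_maxnP (fun x => #|[pred y | R y x]|) Ax0.
exists m => // y Ay; apply/negP => Rmy.
have := maxm y Ay; apply/negP; rewrite -ltnNge.
apply/proper_card/properP; split; last by exists m; rewrite ?inE ?Rirr.
by apply/fintype.subsetP => z; rewrite !inE => /Rtr /(_ Rmy).
Qed.

Definition top_edge (B : bratteli) n (e : edge B n) :=
  [forall e', ~~ elt e e'].
Definition bot_edge (B : bratteli) n (e : edge B n) :=
  [forall e', ~~ elt e' e].
Definition edge_cover (B : bratteli) n (e e' : edge B n) :=
  elt e e' && [forall z, ~~ (elt e z && elt z e')].

Section Edges.
Variable B : bratteli.
Implicit Types (n : nat).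

Lemma top_edgeP n (e e' : edge B n) : top_edge e -> ~ elt e e'.
Proof. by move=> /forallP /(_ e') /negP. Qed.

Lemma bot_edgeP n (e e' : edge B n) : bot_edge e -> ~ elt e' e.
Proof. by move=> /forallP /(_ e') /negP. Qed.

Lemma edge_coverP n (e e' : edge B n) : edge_cover e e' ->
  elt e e' /\ forall z, elt e z -> elt z e' -> False.
Proof.
case/andP=> l /forallP h; split => // z ez ze'.
by have := h z; rewrite ez ze'.
Qed.

Lemma top_edge_exists n (v : vtx B n.+1) : exists2 e, rng e = v & top_edge e.
Proof.
have [e0 /eqP e0v] := rng_surj v.
have [||| e /eqP ev emax] := @exists_maximal _ (@elt B n) [pred e | rng e == v] e0.
- exact: elt_trans.
- exact: elt_irr.
- by rewrite inE e0v.
exists e => //; apply/forallP => e'; apply/negP => l.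
by have := emax e'; rewrite inE -(elt_rng l) ev eqxx l => /(_ isT).
Qed.

Lemma bot_edge_exists n (v : vtx B n.+1) : exists2 e, rng e = v & bot_edge e.
Proof.
have [e0 /eqP e0v] := rng_surj v.
have [||| e /eqP ev emin] :=
    @exists_maximal _ (fun e e' => @elt B n e' e) [pred e | rng e == v] e0.
- by move=> y x z l1 l2; exact: elt_trans l2 l1.
- exact: elt_irr.
- by rewrite inE e0v.
exists e => //; apply/forallP => e'; apply/negP => l.
by have := emin e'; rewrite inE (elt_rng l) ev eqxx l => /(_ isT).
Qed.

Lemma edge_cover_above n (e : edge B n) :
  ~~ top_edge e -> exists e', edge_cover e e'.
Proof.
case/forallPn => e0 /negPn l0.
have [||| e' le' minP] :=
    @exists_maximal _ (fun e e' => @elt B n e' e) [pred x | elt e x] e0.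
- by move=> y x z l1 l2; exact: elt_trans l2 l1.
- exact: elt_irr.
- by rewrite inE.
exists e'; apply/andP; split=> //; apply/forallP => z; apply/negP => /andP[ez ze'].
by have := minP z; rewrite inE ez ze' => /(_ isT).
Qed.

Lemma edge_cover_below n (e : edge B n) :
  ~~ bot_edge e -> exists e', edge_cover e' e.
Proof.
case/forallPn => e0 /negPn l0.
have [||| e' le' maxP] :=
    @exists_maximal _ (@elt B n) [pred x | elt x e] e0.
- exact: elt_trans.
- exact: elt_irr.
- by rewrite inE.
exists e'; apply/andP; split=> //; apply/forallP => z; apply/negP => /andP[ez ze'].
by have := maxP z; rewrite inE ze' ez => /(_ isT).
Qed.

Lemma maximal_pathP (x : ipath B) :
  maximal_path x <-> forall n, top_edge (x n).
Proof.
split=> h n; first by apply/forallP => e; exact: h.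
by move=> e; have /forallP := h n; apply.
Qed.

Lemma minimal_pathP (x : ipath B) :
  minimal_path x <-> forall n, bot_edge (x n).
Proof.
split=> h n; first by apply/forallP => e; exact: h.
by move=> e; have /forallP := h n; apply.
Qed.

Lemma ipath_lt_irr (x : ipath B) : ~ ipath_lt x x.
Proof. by case=> n []; rewrite elt_irr. Qed.

Lemma ipath_lt_trans (y x z : ipath B) :
  ipath_lt x y -> ipath_lt y z -> ipath_lt x z.
Proof.
move=> [a [xy eqxy]] [b [yz eqyz]]; case: (ltngtP a b) => ab.
- exists b; split; first by rewrite eqxy.
  by move=> m bm; rewrite eqxy ?eqyz// (ltn_trans ab).
- exists a; split; first by rewrite -eqyz.
  by move=> m bm; rewrite eqxy ?eqyz// (ltn_trans ab).
- subst b; exists a; split; first exact: elt_trans xy yz.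
  by move=> m bm; rewrite eqxy ?eqyz.
Qed.

Lemma ipath_lt_total N (x y : ipath B) :
  (forall m, (N <= m)%N -> x m = y m) ->
  [\/ x = y, ipath_lt x y | ipath_lt y x].
Proof.
elim: N => [|N IHN] eqxy; first by constructor 1; apply: ipath_ext => n; exact: eqxy.
have [eqN|neN] := eqVneq (x N) (y N).
  apply: IHN => m; rewrite leq_eqVlt => /predU1P[<-//|]; exact: eqxy.
have eqr : rng (x N) = rng (y N) by rewrite -!ipathP eqxy.
case/orP: (elt_total neN eqr) => l; first by constructor 2; exists N.
by constructor 3; exists N; split=> // m ltNm; rewrite eqxy.
Qed.

Lemma maximal_no_gt (x y : ipath B) : ipath_lt x y -> ~ maximal_path x.
Proof. by move=> [n [l _]] /(_ n (y n)); rewrite l. Qed.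

Lemma minimal_no_lt (x y : ipath B) : ipath_lt x y -> ~ minimal_path y.
Proof. by move=> [n [l _]] /(_ n (x n)); rewrite l. Qed.

(** The explicit form of the successor relation, as for an odometer: only the
    levels up to [l] change, from maximal edges below [l] to minimal ones. *)
Definition vstep l (x y : ipath B) :=
  [/\ forall i, (i < l)%N -> top_edge (x i) /\ bot_edge (y i),
      edge_cover (x l) (y l) & forall m, (l < m)%N -> x m = y m].

(** The lowest nonmaximal edge is raised, and everything below it is reset to
    minimal edges. *)
Lemma vstep_above (x : ipath B) :
  ~ maximal_path x -> exists y l, vstep l x y.
Proof.
move=> nmax; have : exists n, ~~ top_edge (x n).
  apply: contrapT => h; apply: nmax; apply/maximal_pathP => n.
  by apply/negPn/negP => h'; apply: h; exists n.
move=> /ex_minnP[l ntop minl].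
have [e cov] := edge_cover_above ntop; have [lt _] := edge_coverP cov.
have [||y [yl yt yb]] := graft bot_edge_exists (n := l) (e := e) (t := x).
- by move=> *; exact: ipathP.
- by rewrite ipathP (elt_rng lt).
exists y, l; split=> [i il||m lm]; last by rewrite yt.
  split; last exact: yb.
  by apply/negPn/negP => /minl; rewrite leqNgt il.
by rewrite yl.
Qed.

Lemma vstep_below (y : ipath B) :
  ~ minimal_path y -> exists x l, vstep l x y.
Proof.
move=> nmin; have : exists n, ~~ bot_edge (y n).
  apply: contrapT => h; apply: nmin; apply/minimal_pathP => n.
  by apply/negPn/negP => h'; apply: h; exists n.
move=> /ex_minnP[l ntop minl].
have [e cov] := edge_cover_below ntop; have [lt _] := edge_coverP cov.
have [||x [xl xt xb]] := graft top_edge_exists (n := l) (e := e) (t := y).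
- by move=> *; exact: ipathP.
- by rewrite ipathP (elt_rng lt).
exists x, l; split=> [i il||m lm]; last by rewrite xt.
  split; first exact: xb.
  by apply/negPn/negP => /minl; rewrite leqNgt il.
by rewrite xl.
Qed.

Lemma vstep_lt l (x y : ipath B) : vstep l x y -> ipath_lt x y.
Proof. by case=> _ /edge_coverP[lt _] eqxy; exists l. Qed.

Lemma vstep_successor l (x y : ipath B) : vstep l x y -> is_successor x y.
Proof.
move=> st; split; first exact: vstep_lt st.
have [ext /edge_coverP[lt cov] eqxy] := st.
move=> z [[a [xz eqxz]] [b [zy eqzy]]].
have la : (l <= a)%N.
  by rewrite leqNgt; apply/negP => /ext[/top_edgeP ] /(_ _ xz).
have lb : (l <= b)%N.
  by rewrite leqNgt; apply/negP => /ext[_ /bot_edgeP] /(_ _ zy).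
case: (ltngtP a b) => ab.
- by move: zy; rewrite -eqxz// eqxy ?elt_irr// (leq_ltn_trans la).
- by move: xz; rewrite eqzy// eqxy ?elt_irr// (leq_ltn_trans lb).
- subst b; move: la; rewrite leq_eqVlt => /predU1P[la|la].
    by subst a; exact: cov xz zy.
  by move: zy; rewrite -eqxy// => /(elt_trans xz); rewrite elt_irr.
Qed.

Lemma ipath_lt_tail (x y : ipath B) : ipath_lt x y ->
  exists N, forall m, (N <= m)%N -> x m = y m.
Proof. by move=> [n [_ h]]; exists n.+1. Qed.

Lemma successor_uniq (x y y' : ipath B) :
  is_successor x y -> is_successor x y' -> y = y'.
Proof.
move=> [xy sy] [xy' sy'].
have [N h] := ipath_lt_tail xy; have [N' h'] := ipath_lt_tail xy'.
have [|//|l|l] := @ipath_lt_total (maxn N N') y y'.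
- by move=> m; rewrite geq_max => /andP[Nm N'm]; rewrite -h// h'.
- by case: (sy' y).
- by case: (sy y').
Qed.

Lemma predecessor_uniq (x x' y : ipath B) :
  is_successor x y -> is_successor x' y -> x = x'.
Proof.
move=> [xy sy] [xy' sy'].
have [N h] := ipath_lt_tail xy; have [N' h'] := ipath_lt_tail xy'.
have [|//|l|l] := @ipath_lt_total (maxn N N') x x'.
- by move=> m; rewrite geq_max => /andP[Nm N'm]; rewrite h// h'.
- by case: (sy x').
- by case: (sy' x).
Qed.

Lemma successor_vstep (x y : ipath B) :
  is_successor x y -> exists l, vstep l x y.
Proof.
move=> s; have [z [l st]] := vstep_above (maximal_no_gt s.1).
by exists l; rewrite (successor_uniq s (vstep_successor st)).
Qed.

End Edges.

(** * The Vershik map as a bijection *)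

Section Vershik.
Variables (B : bratteli) (poB : properly_ordered B).
Implicit Types x y z : ipath B.

Lemma vershikP x : (maximal_path x -> minimal_path (vershik x)) /\
  (~ maximal_path x -> is_successor x (vershik x)).
Proof.
rewrite /vershik; set A := [set y | _].
have [y Ay] : A !=set0.
  have [maxx|nmax] := pselect (maximal_path x).
    by have [_ [y [miny _]]] := poB; exists y.
  by have [y [l /vstep_successor s]] := vstep_above nmax; exists y.
exact: (xgetPex x (ex_intro A y Ay)).
Qed.

Lemma vershik_successor x y : is_successor x y -> vershik x = y.
Proof.
move=> s; apply: successor_uniq (s).
by apply: (vershikP x).2; exact: maximal_no_gt s.1.
Qed.

Lemma vershik_max x y : maximal_path x -> minimal_path y -> vershik x = y.
Proof.
move=> maxx miny; have [_ [m [_ um]]] := poB.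
by rewrite -(um _ miny) -(um _ ((vershikP x).1 maxx)).
Qed.

Lemma vershik_inj : injective (@vershik B).
Proof.
move=> x x' eqv.
have [maxx|nmax] := pselect (maximal_path x);
  have [maxx'|nmax'] := pselect (maximal_path x').
- by have [[M [_ uM]] _] := poB; rewrite -(uM x)// -(uM x').
- have := (vershikP x).1 maxx; rewrite eqv => minv.
  by case: (minimal_no_lt ((vershikP x').2 nmax').1 minv).
- have := (vershikP x').1 maxx'; rewrite -eqv => minv.
  by case: (minimal_no_lt ((vershikP x).2 nmax).1 minv).
- by apply: predecessor_uniq ((vershikP x).2 nmax) _; rewrite eqv; exact: (vershikP x').2.
Qed.

Lemma vershik_surj y : exists x, vershik x = y.
Proof.
have [miny|nmin] := pselect (minimal_path y).
  by have [[M [maxM _]] _] := poB; exists M; exact: vershik_max.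
have [x [l /vstep_successor s]] := vstep_below nmin.
by exists x; exact: vershik_successor.
Qed.

Lemma vershik_invK : cancel (@vershik_inv B) (@vershik B).
Proof. by move=> x; exact: (xgetPex x (vershik_surj x)). Qed.

Lemma vershikK : cancel (@vershik B) (@vershik_inv B).
Proof. by move=> x; apply: vershik_inj; rewrite vershik_invK. Qed.

Lemma iter_vershikK m x : iter m (@vershik_inv B) (iter m (@vershik B) x) = x.
Proof. by elim: m => // m IHm; rewrite iterSr iterS vershikK. Qed.

(** The paths with the same tail as [y] are finitely many, so the orbit of [x]
    climbs to [y]: the number of heads of paths above the current one and with
    the tail of [y] strictly decreases. *)
Lemma vershik_reach N x y :
  (forall m, (N <= m)%N -> x m = y m) -> ipath_lt x y ->
  exists i, iter i (@vershik B) x = y /\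
    forall a, (a < i)%N -> ipath_lt (iter a (@vershik B) x) y /\
      exists2 l, (l < N)%N & vstep l (iter a (@vershik B) x) (iter a.+1 (@vershik B) x).
Proof.
pose head z : {dffun forall i : 'I_N, edge B i} := [ffun i : 'I_N => z i].
pose above z := [pred h | `[< exists u, [/\ head u = h, ipath_lt z u &
      forall m, (N <= m)%N -> u m = y m] >] ].
have [k] := ubnP #|above x|; elim: k x => // k IHk x cardx tailx ltxy.
have [n [ltn eqn]] := ltxy.
have nN : (n < N)%N.
  by rewrite ltnNge; apply/negP => /tailx eqxy; move: ltn; rewrite eqxy elt_irr.
have sx := (vershikP x).2 (maximal_no_gt ltxy).
have [l st] := successor_vstep sx; set x' := vershik x in sx st *.
have [ext cov eqxx'] := st.
have ln : (l <= n)%N.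
  by rewrite leqNgt; apply/negP => /ext[/top_edgeP] /(_ _ ltn).
have tailx' m : (N <= m)%N -> x' m = y m.
  by move=> Nm; rewrite -tailx// eqxx'//; apply: leq_trans Nm; apply: leq_ltn_trans nN.
have [eqx'y|ltx'y|ltyx'] := ipath_lt_total tailx'; last by case: (sx.2 y).
  exists 1; split=> // -[_|//]; split=> //; exists l => //.
  exact: leq_ltn_trans nN.
have [|i [itx' lti]] := IHk x' _ tailx' ltx'y.
  rewrite -ltnS; apply: leq_trans cardx; rewrite ltnS; apply/proper_card/properP; split.
    apply/fintype.subsetP => h; rewrite !inE => -[u [uh x'u ut]].
    exists u; split=> //; exact: ipath_lt_trans sx.1 x'u.
  exists (head x'); first by rewrite inE; exists x'; split=> //; case: sx.
  apply/negP; rewrite inE => -[u [uh x'u ut]]; suff eqx'u : x' = u.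
    by move: x'u; rewrite -eqx'u => /ipath_lt_irr.
  apply: ipath_ext => m; have [Nm|mN] := leqP N m; first by rewrite ut// tailx'.
  by move/ffunP/(_ (Ordinal mN)): uh; rewrite !ffunE.
exists i.+1; rewrite iterSr; split=> // -[_|a ai].
  split=> //; exists l => //; exact: leq_ltn_trans nN.
rewrite !(iterSr _ _ x); exact: lti.
Qed.

End Vershik.

Lemma vershik_iter_conj (B1 B2 : bratteli) (f : ipath B1 -> ipath B2) :
  properly_ordered B1 -> properly_ordered B2 ->
  (forall x, f (vershik x) = vershik (f x)) ->
  forall n x, f (vershik_iter n x) = vershik_iter n (f x).
Proof.
move=> po1 po2 fv; have fvi x : f (vershik_inv x) = vershik_inv (f x).
  by apply: (vershik_inj po2); rewrite -fv !vershik_invK.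
case=> m x; rewrite /vershik_iter.
  by elim: m => //= m <-.
by elim: m.+1 => //= p <-.
Qed.

(** * Topology of path spaces *)

Section Topology.
Variable B : bratteli.
Implicit Types (x y : ipath B) (A : set (ipath B)).

Lemma open_cylinder x n : open (cylinder (x, n)).
Proof.
exists [set cylinder (x, n)]; last by rewrite bigcup_set1.
move=> _ ->; exists [fset (x, n)]%fset; first by move=> c _; rewrite inE.
by rewrite set_fset1 bigcap_set1.
Qed.

Lemma open_ipathP A :
  open A <-> forall x, A x -> exists n, cylinder (x, n) `<=` A.
Proof.
split=> [[D sD DA] x Ax|h].
  have bigDA : \bigcup_(V in D) V = A := DA.
  have [V DV Vx] : (\bigcup_(V in D) V) x by rewrite bigDA.
  have [F _ VF] := sD _ DV; exists (\max_(c <- F) c.2)%N => y xy.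
  rewrite -bigDA; exists V => //; rewrite -VF => c cF /= i ic.
  have := Vx; rewrite -VF => /(_ c cF) /(_ i ic) ->; apply: xy => /=.
  exact: leq_trans ic (leq_bigmax_seq _ cF _).
have -> : A = \bigcup_(c in [set c | cylinder c `<=` A]) cylinder c.
  apply/seteqP; split=> [x Ax|x [c cA cx]]; last exact: cA.
  by have [n xnA] := h x Ax; exists (x, n).
by apply: bigcup_open => -[x n] _; exact: open_cylinder.
Qed.

Lemma nbhs_cylinder x n : nbhs x (cylinder (x, n)).
Proof. by apply: open_nbhs_nbhs; split; [exact: open_cylinder|move=> i]. Qed.

Lemma nbhs_ipathP x A : nbhs x A <-> exists n, cylinder (x, n) `<=` A.
Proof.
split=> [|[n /filterS]]; last by apply; exact: nbhs_cylinder.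
rewrite nbhsE => -[V [/open_ipathP oV Vx] VA].
by have [n xn] := oV x Vx; exists n => y /xn /VA.
Qed.

Lemma clopen_cylinder x n : clopen (cylinder (x, n)).
Proof.
split; first exact: open_cylinder.
rewrite -openC; apply/open_ipathP => y nxy; exists n => z yz xz.
by apply: nxy => i ni; rewrite (xz i ni) (yz i ni).
Qed.

Lemma zero_dimensional_ipath : zero_dimensional (ipath B).
Proof.
move=> x y /eqP /ipath_neq[n nen].
exists (cylinder (x, n)); split; first exact: clopen_cylinder.
  by move=> i.
by move=> /(_ n (leqnn n)).
Qed.

Lemma hausdorff_ipath : hausdorff_space (ipath B).
Proof.
move=> x y clxy; apply: ipath_ext => n.
have [z [xz yz]] := clxy _ _ (nbhs_cylinder x n) (nbhs_cylinder y n).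
by rewrite (xz n) ?(yz n) /=.
Qed.

(** Along an ultrafilter the [n]-th edge is eventually constant, since there
    are finitely many; these constants form the limit path. *)
Lemma compact_ipath : compact [set: ipath B].
Proof.
rewrite compact_ultra => F FU _.
have FP : ProperFilter F by exact: ultra_proper.
have edgeF n : exists e : edge B n, F [set x : ipath B | x n = e].
  apply: contrapT => nF.
  have : F [set x : ipath B | forall e : edge B n, x n <> e].
    apply: filter_forall => e.
    have [h|//] := in_ultra_setVsetC [set x : ipath B | x n = e] FU.
    by case: nF; exists e.
  by move/filter_ex => [x] /(_ (x n)); apply.
pose z n := projT1 (cid (edgeF n)).
have zF n : F [set x : ipath B | x n = z n] := projT2 (cid (edgeF n)).
have zP n : src (z n.+1) = rng (z n).
  have [x [<- <-]] := filter_ex (filterI (zF n.+1) (zF n)); exact: ipathP.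
exists (IPath zP); split=> // A /nbhs_ipathP[n xA].
apply: (@filterS _ F _ _ _ xA) => {A xA}.
elim: n => [|n IHn].
  by apply: filterS (zF 0) => y yz i; rewrite leqn0 => /eqP ->.
apply: filterS (filterI IHn (zF n.+1)) => y [yn yz] i.
rewrite leq_eqVlt => /predU1P[->//|]; exact: yn.
Qed.

Lemma perfect_ipathP : perfect_set [set: ipath B] <->
  forall x n, exists y, same_head n x y /\ x <> y.
Proof.
rewrite perfectTP; split=> [h x n|h x /open_ipathP /(_ x erefl)[n xn]].
  apply: contrapT => nh; apply: (h x); rewrite [X in open X](_ : _ = cylinder (x, n)).
    exact: open_cylinder.
  apply/seteqP; split=> y; first by move=> -> i.
  by move=> xy; apply: contrapT => nxy; apply: nh; exists y; split=> // /esym.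
by have [y [xy nxy]] := h x n; apply: nxy; rewrite (xn y xy).
Qed.

(** The other three properties hold in every path space. *)
Lemma cantor_like_ipathP : cantor_like (ipath B) <->
  forall x n, exists y, same_head n x y /\ x <> y.
Proof.
split=> [[/perfect_ipathP//]|h]; split; first exact/perfect_ipathP.
- exact: compact_ipath.
- exact: hausdorff_ipath.
- exact: zero_dimensional_ipath.
Qed.

Lemma open_edge n (e : edge B n) : open [set x : ipath B | x n = e].
Proof.
by apply/open_ipathP => x xe; exists n => y /(_ n (leqnn n)) /= <-.
Qed.

End Topology.

(** * Finite segments of paths *)

Section Segments.
Variable B : bratteli.
Implicit Types x y : ipath B.

Definition seg (n m : nat) x : Defs.fpath B n m := fpath_of (fun i _ => ipathP x (i + n)).

Lemma segE (n m : nat) x (i : 'I_m.+1) : val (seg n m x) i = x (i + n)%N.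
Proof. by rewrite ffunE. Qed.

Lemma seg_src n m x : fpath_src (seg n m x) = src (x n).
Proof. by rewrite /fpath_src segE. Qed.

Lemma seg_rng n m x : fpath_rng (seg n m x) = rng (x (m + n)%N).
Proof. by rewrite /fpath_rng segE. Qed.

Lemma seg_eqP n m x y : seg n m x = seg n m y <->
  forall l, (n <= l)%N -> (l <= m + n)%N -> x l = y l.
Proof.
split=> [eqxy l nl lm|eqxy].
  have lm' : (l - n < m.+1)%N by rewrite ltnS leq_subLR addnC.
  have := congr1 (fun p : Defs.fpath B n m => val p (Ordinal lm')) eqxy.
  by rewrite !segE /= subnK.
apply/val_inj/ffunP => i; rewrite !segE; apply: eqxy; first exact: leq_addl.
by rewrite leq_add2r -ltnS.
Qed.

End Segments.

Definition edges_between (B : bratteli) n (v : vtx B n) (w : vtx B n.+1) :=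
  [pred e : edge B n | (src e == v) && (rng e == w)].

Lemma connected_simple (B : bratteli) :
  (forall n (v : vtx B n) (w : vtx B n.+1), exists e : edge B n, src e = v /\ rng e = w) ->
  simple_diagram B.
Proof.
move=> con; exists (fun=> 0%N) => n v w.
have [e [ev ew]] := con _ v w; have [x xe] := through_edge e.
exists (seg _ 0 x); split; first by rewrite [LHS]seg_src xe.
by rewrite [LHS]seg_rng xe.
Qed.

(** * Invariant measures *)

Lemma replace_edge (B : bratteli) n (x : ipath B) (f : edge B n) :
  src f = src (x n) -> rng f = rng (x n) ->
  exists y : ipath B, y n = f /\ forall i, i != n -> y i = x i.
Proof.
move=> sf rf; pose y := eqtype.dfwith x f.
have yP i : src (y i.+1) = rng (y i).
  rewrite /y; have [E|ne] := eqVneq i n.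
    by subst i; rewrite eqtype.dfwith_in eqtype.dfwith_out ?ltn_eqF// ipathP.
  rewrite [in RHS]eqtype.dfwith_out 1?eq_sym// -ipathP.
  have [E|ne'] := eqVneq i.+1 n; first by subst n; rewrite eqtype.dfwith_in.
  by rewrite eqtype.dfwith_out// eq_sym.
exists (IPath yP); split=> [|i ne] /=; rewrite /y; first by rewrite eqtype.dfwith_in.
by rewrite eqtype.dfwith_out// eq_sym.
Qed.

Definition ext_edge (B : bratteli) n (e : edge B n) := top_edge e || bot_edge e.

(** The edges into [w] are totally ordered, so one is maximal and one minimal. *)
Lemma card_ext_edge (B : bratteli) n (w : vtx B n.+1) :
  (#|[pred e : edge B n | ext_edge e && (rng e == w)]| <= 2)%N.
Proof.
have le1 (P : pred (edge B n)) :
    (forall e f, P e -> P f -> elt e f -> False) ->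
    (#|[pred e | P e && (rng e == w)]| <= 1)%N.
  move=> hP; apply/card_le1_eqP => e f; rewrite !inE.
  move=> /andP[Pe /eqP re] /andP[Pf /eqP rf]; apply/eqP/negPn/negP => ne.
  have := elt_total ne; rewrite re rf => /(_ erefl) /orP[]; exact: hP.
have := leq_add (le1 (@top_edge B n) _) (le1 (@bot_edge B n) _).
rewrite addn1 => /(_ (fun e f te _ => top_edgeP te) (fun e f _ bf => bot_edgeP bf)).
apply: leq_trans; rewrite -cardUI; apply: leq_trans (leq_addr _ _).
apply/subset_leq_card/fintype.subsetP => e; rewrite !inE /ext_edge.
by case: (rng e == w); rewrite ?andbT ?andbF.
Qed.

Section Measure.
Variables (R : realType) (B : bratteli) (poB : properly_ordered B).
Variables (mu : probability (borel_ipath B) R) (invmu : invariant_measure mu).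
Local Notation X := (borel_ipath B).

(** A step at a level [l <= n] changes and depends on the [n]-head only, so it
    can be copied to all paths with the same head; together with the injectivity
    of the Vershik map this gives both inclusions. *)
Lemma vstep_cylinder l n (x x' : ipath B) : (l <= n)%N -> vstep l x x' ->
  @vershik B @^-1` cylinder (x', n) = cylinder (x, n).
Proof.
move=> ln [ext cov tl]; have [lt _] := edge_coverP cov.
have rn : rng (x n) = rng (x' n).
  move: ln; rewrite leq_eqVlt => /predU1P[E|ln]; last by rewrite tl.
  by subst n; exact: elt_rng.
apply/seteqP; split=> z /= xz.
- have nmax : ~ maximal_path z.
    move=> maxz; have /minimal_pathP/(_ l) := (vershikP poB z).1 maxz.
    by rewrite -xz// => /bot_edgeP; apply; exact: lt.
  have [l' st] := successor_vstep ((vershikP poB z).2 nmax).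
  have [ext' cov' tl'] := st.
  have l'n : (l' <= n)%N.
    rewrite leqNgt; apply/negP => nl'.
    have [_] := ext' l (leq_ltn_trans ln nl').
    by rewrite -xz// => /bot_edgeP; apply; exact: lt.
  pose z' := splice n x z.
  have zx i : (i <= n)%N -> z' i = x i := @splice_le _ _ _ _ _.
  have zz i : (n < i)%N -> z' i = z i.
    by apply: splice_gt; rewrite tl' ?ltnS// ipathP rn xz.
  have -> : z = z'.
    apply: (vershik_inj poB); symmetry; apply: (vershik_successor poB).
    apply: (@vstep_successor _ l); split=> [i il||m lm].
    + have inn : (i <= n)%N by rewrite ltnW// (leq_trans il).
      by rewrite zx// -xz//; exact: ext.
    + by rewrite zx// -xz.
    + have [mn|nm] := leqP m n; first by rewrite zx// -xz// tl.
      by rewrite zz// tl'// (leq_ltn_trans l'n).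
  by move=> i ni; rewrite zx.
- pose z' := splice n x' z.
  have zx i : (i <= n)%N -> z' i = x' i := @splice_le _ _ _ _ _.
  have zz i : (n < i)%N -> z' i = z i by apply: splice_gt; rewrite ipathP -xz.
  suff -> : vershik z = z' by move=> i ni; rewrite zx.
  apply: (vershik_successor poB); apply: (@vstep_successor _ l).
  split=> [i il||m lm].
  + have inn : (i <= n)%N by rewrite ltnW// (leq_trans il).
    by rewrite zx// -xz//; exact: ext.
  + by rewrite zx// -xz.
  + have [mn|nm] := leqP m n; first by rewrite zx// -xz// tl.
    by rewrite zz.
Qed.

Lemma measurable_cylinder (x : ipath B) n : measurable (cylinder (x, n) : set X).
Proof. by apply: sub_sigma_algebra; exact: open_cylinder. Qed.

Lemma measurable_edge n (e : edge B n) : measurable ([set x | x n = e] : set X).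
Proof. by apply: sub_sigma_algebra; exact: open_edge. Qed.

(** Cylinders ending in the same vertex are translates of each other under
    powers of the Vershik map. *)
Lemma cylinder_measure n (x y : ipath B) : rng (x n) = rng (y n) ->
  mu (cylinder (x, n)) = mu (cylinder (y, n)).
Proof.
have main (x' y' : ipath B) : (forall m, (n < m)%N -> x' m = y' m) -> ipath_lt x' y' ->
    mu (cylinder (x', n)) = mu (cylinder (y', n)).
  move=> tl /(vershik_reach poB tl) [i [<- reach]].
  have {reach} step a (ai : (a < i)%N) := (reach a ai).2.
  elim: i step => //= i IHi step; rewrite IHi; last first.
    by move=> a ai; apply: step; rewrite ltnW.
  have [l] := step i (leqnn _); rewrite ltnS => ln /(vstep_cylinder ln) <-.
  by apply: invmu; exact: measurable_cylinder.
move=> rxy; pose y' := splice n y x.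
have yy i : (i <= n)%N -> y' i = y i := @splice_le _ _ _ _ _.
have yx i : (n < i)%N -> y' i = x i by apply: splice_gt; rewrite ipathP.
have -> : cylinder (y, n) = cylinder (y', n).
  by apply/seteqP; split=> z h i ni; have := h i ni; rewrite /= yy.
have tl m : (n < m)%N -> x m = y' m by move=> /yx.
by have [->//|/(main _ _ tl)//|/main -> //] := ipath_lt_total tl.
Qed.

(** Exchanging [e] and [f] permutes the cylinders of level [n], head by head,
    and preserves their end vertices. *)
Lemma parallel_edge_measure n (e f : edge B n) : src e = src f -> rng e = rng f ->
  mu [set x | x n = e] = mu [set x | x n = f].
Proof.
move=> sef ref; pose H : finType := {dffun forall i : 'I_n, edge B i}.
pose D (g : edge B n) (h : H) := [set x : X | x n = g /\ forall i : 'I_n, x i = h i].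
have DE (g : edge B n) (x : X) (h : H) : D g h x -> D g h = cylinder (x, n).
  move=> [xg xh]; apply/seteqP; split=> y.
    move=> [yg yh] i; rewrite leq_eqVlt => /predU1P[->|ni]; first by rewrite xg.
    by rewrite (xh (Ordinal ni)) (yh (Ordinal ni)).
  move=> xy; split=> [|i]; first by rewrite -xy.
  by rewrite -xy /= ?xh// ltnW.
have swap (g g' : edge B n) h (x : X) : src g = src g' -> rng g = rng g' -> D g h x ->
    exists y : X, D g' h y.
  move=> sg rg [xg xh]; have [||y [yn yi]] := @replace_edge B n x g'.
  - by rewrite xg.
  - by rewrite xg.
  by exists y; split=> // i; rewrite yi ?xh// ltn_eqF.
have mD g h : measurable (D g h).
  have [[x /DE ->]|nD] := pselect (exists x, D g h x); first exact: measurable_cylinder.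
  have -> : D g h = set0 by apply/seteqP; split=> // x Dx; apply: nD; exists x.
  exact: measurable0.
have split g : mu [set x | x n = g] = (\sum_(h \in [set: H]) mu (D g h))%E.
  have finH : finite_set [set: H] by exact: finite_finset.
  rewrite -measure_fin_bigcup//.
  - congr (mu _); apply/seteqP; split=> x /=; last by case=> h _ [].
    by move=> xg; exists [ffun i : 'I_n => x i] => //; split=> // i; rewrite ffunE.
  - move=> h h' _ _ [x [[_ xh] [_ xh']]]; apply/ffunP => i.
    by rewrite -xh -xh'.
rewrite !split; apply: eq_fsbigr => h _.
have [[x De]|nD] := pselect (exists x, D e h x).
  have [y Df] := swap e f h x sef ref De.
  rewrite (DE _ _ _ De) (DE _ _ _ Df); apply: cylinder_measure.
  by rewrite De.1 Df.1.
have emp g : src g = src e -> rng g = rng e -> D g h = set0.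
  move=> sg rg; apply/seteqP; split=> // x Dx; apply: nD; exact: swap Dx.
by rewrite !emp.
Qed.

Let m n (e : edge B n) : R := fine (mu [set x | x n = e]).

Local Open Scope ring_scope.

Let mE n (e : edge B n) : mu [set x | x n = e] = (m e)%:E.
Proof. by rewrite /m fineK// fin_num_measure//; exact: measurable_edge. Qed.

Let m0 n (e : edge B n) : 0 <= m e.
Proof. by rewrite /m fine_ge0. Qed.

Lemma edge_set_measure n (P : pred (edge B n)) :
  mu [set x | P (x n)] = (\sum_(e | P e) m e)%:E.
Proof.
transitivity (mu (\bigcup_(e in [set e | P e]) [set x : X | x n = e])).
  congr (mu _); apply/seteqP; split=> x /=; last by move=> [e Pe ->].
  by move=> Px; exists (x n).
rewrite measure_fin_bigcup//; last 3 first.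
- exact: finite_finset.
- by move=> e e' _ _ [x [<- <-]].
- by move=> e _; exact: measurable_edge.
transitivity (\sum_(e \in [set e | P e]) (m e)%:E)%E.
  by apply: eq_fsbigr => e _; exact: mE.
rewrite fsbig_finite//= -sumEFin -[RHS]big_enum /=.
apply: perm_big; apply: uniq_perm => [||e]; rewrite ?fset_uniq ?enum_uniq//.
rewrite in_fset_set; first by rewrite mem_enum mem_setE.
exact: finite_finset.
Qed.

(** Every edge has at least [N] parallel copies of the same mass, and at most
    two extremal edges end in a given vertex. *)
Lemma ext_edge_measure n N :
  (forall (v : vtx B n) (w : vtx B n.+1),
    (N <= #|edges_between v w|)%N) ->
  exists2 r : R, mu [set x : X | ext_edge (x n)] = r%:E & N%:R * r <= 2.
Proof.
move=> par; rewrite edge_set_measure; exists (\sum_(e : edge B n | ext_edge e) m e) => //.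
have mass1 : \sum_(e : edge B n) m e = 1.
  apply: EFin_inj; rewrite -(@edge_set_measure n predT) -(probability_setT mu).
  by congr (mu _); apply/seteqP; split.
rewrite mulr_sumr.
apply: (@le_trans _ _
    (\sum_(f : edge B n | ext_edge f) \sum_(e : edge B n | rng e == rng f) m e)).
  apply: ler_sum => f _.
  apply: (@le_trans _ _ (\sum_(e : edge B n | (src e == src f) && (rng e == rng f)) m e)).
    have eqm e : (src e == src f) && (rng e == rng f) -> m e = m f.
      by move=> /andP[/eqP se /eqP re]; congr fine; exact: parallel_edge_measure.
    rewrite (eq_bigr _ eqm) sumr_const -[leRHS]mulr_natl ler_wpM2r// ler_nat; exact: par.
  rewrite [leRHS](bigID (fun e => src e == src f)) /=.
  under eq_bigl do rewrite andbC.
  by rewrite lerDl sumr_ge0.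
rewrite (exchange_big_dep predT)//=.
apply: (@le_trans _ _ (\sum_(e : edge B n) 2 * m e)); last first.
  by rewrite -mulr_sumr mass1 mulr1.
apply: ler_sum => e _; rewrite sumr_const -[leLHS]mulr_natl ler_wpM2r//.
rewrite ler_nat; apply: leq_trans (card_ext_edge (rng e)).
by apply: subset_leq_card; apply/fintype.subsetP => f; rewrite !inE eq_sym.
Qed.

(** With at least [2 ^ n.+2] parallel edges, the paths whose [n]-th edge is
    extremal have mass at most [1 / 2 ^ n.+1], so Borel-Cantelli applies. *)
Lemma ext_edges_null :
  (forall n (v : vtx B n) (w : vtx B n.+1),
    (2 ^ n.+2 <= #|edges_between v w|)%N) ->
  mu (lim_sup_set (fun n => [set x : X | ext_edge (x n)])) = 0%E.
Proof.
move=> par; apply: lim_sup_set_cvg0 => [n|].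
  rewrite [Y in measurable Y](_ : _ = 
      \bigcup_(e in [set e | ext_edge e]) [set x : X | x n = e]); last first.
    apply/seteqP; split=> x /=; last by move=> [e Pe ->].
    by move=> Px; exists (x n).
  by apply: fin_bigcup_measurable => // e _; exact: measurable_edge.
apply: (@le_lt_trans _ _ 1%:E); last exact: ltry.
apply: le_trans (epsilon_trick0 xpredT ler01).
apply: lee_nneseries => // n _.
have [r mur h] := ext_edge_measure (par n).
apply: (@le_trans _ _ r%:E); first by have := lexx r%:E; rewrite -{1}mur.
rewrite lee_fin.
rewrite ler_pdivlMr ?ltr0n ?expn_gt0//.
rewrite -(ler_pM2l (_ : 0 < 2 :> R))// mulr1; apply: le_trans h.
by rewrite [(2 ^ n.+2)%N]expnS natrM -mulrA [r * _]mulrC.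
Qed.

End Measure.

(** * Telescoping *)

(** Maximality of a path depends on the order of the path space only; hence so
    does the Vershik map, which makes it invariant under order isomorphisms. *)
Lemma maximal_path_lt (B : bratteli) (x : ipath B) :
  maximal_path x <-> forall y, ~ ipath_lt x y.
Proof.
split=> [maxx y /maximal_no_gt//|h]; apply: contrapT => /vstep_above[y [l]].
by move/vstep_lt/h.
Qed.

Lemma minimal_path_lt (B : bratteli) (x : ipath B) :
  minimal_path x <-> forall y, ~ ipath_lt y x.
Proof.
split=> [maxx y /minimal_no_lt//|h]; apply: contrapT => /vstep_below[y [l]].
by move/vstep_lt/h.
Qed.

Section OrderIso.
Variables (B1 B2 : bratteli) (f : ipath B1 -> ipath B2).
Hypothesis f_surj : forall y, exists x, f x = y.
Hypothesis f_lt : forall x y, ipath_lt (f x) (f y) <-> ipath_lt x y.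

Lemma iso_maximal x : maximal_path (f x) <-> maximal_path x.
Proof.
rewrite !maximal_path_lt; split=> [h y /f_lt /h//|h y].
by have [z <-] := f_surj y => /f_lt /h.
Qed.

Lemma iso_minimal x : minimal_path (f x) <-> minimal_path x.
Proof.
rewrite !minimal_path_lt; split=> [h y /f_lt /h//|h y].
by have [z <-] := f_surj y => /f_lt /h.
Qed.

Lemma iso_properly_ordered : properly_ordered B1 -> properly_ordered B2.
Proof.
move=> [[M [maxM uM]] [m [minm um]]]; split.
  exists (f M); split; first exact/iso_maximal.
  by move=> y; have [x <-] := f_surj y => /iso_maximal /uM ->.
exists (f m); split; first exact/iso_minimal.
by move=> y; have [x <-] := f_surj y => /iso_minimal /um ->.
Qed.

Lemma iso_vershik x : properly_ordered B1 -> f (vershik x) = vershik (f x).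
Proof.
move=> po1; have po2 := iso_properly_ordered po1; symmetry.
have [maxx|nmax] := pselect (maximal_path x).
  apply: (vershik_max po2); first exact/iso_maximal.
  by apply/iso_minimal; exact: (vershikP po1 x).1.
have [lt nb] := (vershikP po1 x).2 nmax.
apply: (vershik_successor po2); split; first exact/f_lt.
by move=> z; have [y <-] := f_surj z => -[/f_lt xy /f_lt yv]; apply: (nb y).
Qed.

End OrderIso.

Section Telescoping.
Variables (B : bratteli) (d : nat -> nat).
Local Notation D := (telescoping B d).

Lemma tlevel_split n : exists k i, (i < (d k).+1)%N /\ n = (i + tlevel d k)%N.
Proof.
elim: n => [|n [k [i [ik ->]]]]; first by exists 0, 0.
move: ik; rewrite ltnS leq_eqVlt => /predU1P[->|ik]; last by exists k, i.+1.
by exists k.+1, 0.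
Qed.

Lemma tlevel_mono k k' : (k <= k')%N -> (tlevel d k <= tlevel d k')%N.
Proof.
move/subnK <-; elim: (k' - k)%N => //= n IHn.
by apply: leq_trans IHn _; rewrite leq_addl.
Qed.

Lemma leq_tlevel k : (k <= tlevel d k)%N.
Proof. by elim: k => //= k IHk; rewrite addSn ltnS (leq_trans IHk)// leq_addl. Qed.

Lemma tlevel_lt k i k' i' : (i < (d k).+1)%N ->
  (i' + tlevel d k' <= i + tlevel d k)%N -> (k' <= k)%N.
Proof.
move=> ik; apply: contraTT; rewrite -!ltnNge => /tlevel_mono le.
apply: leq_trans (leq_addl _ _); apply: leq_trans le.
by rewrite /= ltn_add2r.
Qed.

Lemma tlevel_split_inj k i k' i' : (i < (d k).+1)%N -> (i' < (d k').+1)%N ->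
  (i + tlevel d k = i' + tlevel d k')%N -> k = k' /\ i = i'.
Proof.
move=> ik ik' E; have Ek : k = k'.
  by apply/anti_leq/andP; split;
    [apply: (tlevel_lt (i := i') (i' := i)) => //; rewrite E
    |apply: (tlevel_lt (i := i) (i' := i')) => //; rewrite E].
by subst k'; split=> //; apply/eqP; rewrite -(eqn_add2r (tlevel d k)) E.
Qed.

Lemma tpath_path (x : ipath B) k :
  src (seg (tlevel d k.+1) (d k.+1) x : edge D k.+1) =
  rng (seg (tlevel d k) (d k) x : edge D k).
Proof. by rewrite [LHS]seg_src [RHS]seg_rng -ipathP. Qed.

Definition tpath (x : ipath B) : ipath D :=
  IPath (edge_at := fun k => seg (tlevel d k) (d k) x : edge D k)
    (tpath_path x).

Lemma tpath_eqP (x y : ipath B) k :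
  tpath x k = tpath y k <->
  forall l, (tlevel d k <= l)%N -> (l < tlevel d k.+1)%N -> x l = y l.
Proof. exact: seg_eqP. Qed.

Lemma tpath_inj : injective tpath.
Proof.
move=> x y eqxy; apply: ipath_ext => n; have [k [i [ik ->]]] := tlevel_split n.
have /tpath_eqP : tpath x k = tpath y k by rewrite eqxy.
by apply; rewrite /= ?leq_addl// ltn_add2r.
Qed.

(** Every level of [B] occurs in exactly one segment of [x'], at an index that is
    equal to this level only propositionally, whence the transport. *)
Lemma tpath_surj (x' : ipath D) : exists x, tpath x = x'.
Proof.
have ex n : exists e : edge B n, forall k (i : 'I_(d k).+1) (E : i + tlevel d k = n),
    e = eq_rect _ (edge B) (val (x' k) i) _ E.
  have [k [i [ik ->]]] := tlevel_split n; exists (val (x' k) (Ordinal ik)).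
  move=> k' i' E; have [Ek Ei] := tlevel_split_inj (ltn_ord i') ik E.
  subst k'; have Eo : i' = Ordinal ik by apply/val_inj.
  by subst i'; rewrite (eq_irrelevance E erefl).
pose x n := projT1 (cid (ex n)).
have xE k (i : 'I_(d k).+1) : x (i + tlevel d k) = val (x' k) i.
  exact: (projT2 (cid (ex (i + tlevel d k))) k i erefl).
have xP n : src (x n.+1) = rng (x n).
  have [k [i [ik ->]]] := tlevel_split n.
  have := ik; rewrite {1}ltnS leq_eqVlt => /predU1P[E|ik'].
    subst i; have -> : x (d k + tlevel d k) = val (x' k) ord_max := xE k ord_max.
    rewrite -[RHS]/(rng (x' k)) -(ipathP x' k) -[RHS]/(src (val (x' k.+1) ord0)).
    by rewrite -xE.
  have -> : x (i + tlevel d k).+1 = val (x' k) (lift ord0 (Ordinal ik')) :=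
    xE k (lift ord0 (Ordinal ik')).
  have -> : x (i + tlevel d k) = val (x' k) (widen_ord (leqnSn _) (Ordinal ik')) :=
    xE k (widen_ord (leqnSn _) (Ordinal ik')).
  by have /forallP/(_ (Ordinal ik'))/eqP := valP (x' k).
exists (IPath xP); apply: ipath_ext => k; apply/val_inj/ffunP => i.
by rewrite segE -xE.
Qed.

(** Monotonicity is direct; the converse follows from it, since paths with
    comparable images have a common tail and so are comparable themselves. *)
Lemma tpath_lt (x y : ipath B) :
  ipath_lt (tpath x) (tpath y) <-> ipath_lt x y.
Proof.
have mono (u v : ipath B) : ipath_lt u v -> ipath_lt (tpath u) (tpath v).
  move=> [n [lt eqn]]; have [k [i [ik En]]] := tlevel_split n; subst n.
  exists k; split; last first.
    move=> m km; apply/tpath_eqP => l ml _; apply: eqn; apply: leq_trans ml.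
    by apply: leq_trans (tlevel_mono km); rewrite /= ltn_add2r.
  apply/andP; split.
    apply/eqP => /tpath_eqP => /(_ (i + tlevel d k)).
    rewrite leq_addl /= ltn_add2r => /(_ isT ik) E.
    by move: lt; rewrite E elt_irr.
  apply/orP; right; apply/fpath_ltP; exists (Ordinal ik); first by rewrite !segE.
  by move=> j ij; rewrite !segE eqn// ltn_add2r.
split=> [lt|]; last exact: mono.
have [k [_ eqk]] := lt.
have [m|E|//|/mono lt'] := @ipath_lt_total B (tlevel d k.+1) x y.
- move=> km; have [k' [i [ik' Em]]] := tlevel_split m; subst m.
  have /eqk/tpath_eqP : (k < k')%N.
    rewrite ltnNge; apply/negP => kk'.
    have lt' : (i + tlevel d k' < tlevel d k'.+1)%N by rewrite /= ltn_add2r.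
    by have := leq_trans lt' (tlevel_mono (kk' : (k'.+1 <= k.+1)%N)); rewrite ltnNge km.
  by apply; rewrite ?leq_addl//= ltn_add2r.
- by move: lt; rewrite E => /ipath_lt_irr.
- by have /ipath_lt_irr := ipath_lt_trans lt lt'.
Qed.

End Telescoping.

Section TelescopingProperties.
Variables (B : bratteli) (d : nat -> nat).
Local Notation D := (telescoping B d).
Implicit Types x y : ipath B.

Lemma tpath_same_head k x y :
  same_head k (tpath d x) (tpath d y) -> same_head k x y.
Proof.
move=> h n nk; have [k' [i [ik En]]] := tlevel_split d n; subst n.
have /h/tpath_eqP : (k' <= k)%N.
  by apply: leq_trans (leq_tlevel d k') (leq_trans (leq_addl _ _) nk).
by apply; rewrite ?leq_addl//= ltn_add2r.
Qed.

Lemma tpath_same_headV k x y :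
  same_head (tlevel d k.+1) x y -> same_head k (tpath d x) (tpath d y).
Proof.
move=> h i ik; apply/tpath_eqP => l _ lt; apply: h; apply: ltnW.
by apply: leq_trans lt (tlevel_mono d _); rewrite ltnS.
Qed.

Lemma tpath_properly_ordered : properly_ordered B -> properly_ordered D.
Proof.
exact: (iso_properly_ordered (@tpath_surj B d) (@tpath_lt B d)).
Qed.

Lemma tpath_vershik x :
  properly_ordered B -> tpath d (vershik x) = vershik (tpath d x).
Proof. exact: (iso_vershik (@tpath_surj B d) (@tpath_lt B d)). Qed.

Lemma tpath_cantor_like : cantor_like (ipath B) -> cantor_like (ipath D).
Proof.
move=> /cantor_like_ipathP h; apply/cantor_like_ipathP => x' n.
have [x <-] := tpath_surj x'.
have [y [xy nxy]] := h x (tlevel d n.+1); exists (tpath d y); split.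
  exact: tpath_same_headV.
by move=> /(@tpath_inj B d).
Qed.

Lemma tpath_k_expansive k :
  properly_ordered B -> k_expansive k B -> k_expansive k D.
Proof.
move=> poB kB x' y'; have [x <-] := tpath_surj x'; have [y <-] := tpath_surj y'.
move=> nxy; have [|n nh] := kB x y; first by move=> E; apply: nxy; rewrite E.
exists n => h; apply: nh; apply: (@tpath_same_head k).
have poD := tpath_properly_ordered poB.
have conj := vershik_iter_conj poB poD (fun x => tpath_vershik x poB).
by rewrite !conj.
Qed.

End TelescopingProperties.

(** * Multiplying the edges by telescoping *)

Section ManyPaths.
Variables (B : bratteli) (aB : admissible B).
Implicit Types x y : ipath B.

Lemma seg_le n m m' x y :
  (m <= m')%N -> seg n m' x = seg n m' y -> seg n m x = seg n m y.
Proof.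
move=> mm' /seg_eqP h; apply/seg_eqP => l nl lm; apply: h => //.
by apply: leq_trans lm _; rewrite leq_add2r.
Qed.

Lemma uniq_seg_le n m m' (s : seq (ipath B)) :
  (m <= m')%N -> uniq (map (seg n m) s) -> uniq (map (seg n m') s).
Proof.
move=> mm'; elim: s => //= x s IHs /andP[xs /IHs ->]; rewrite andbT.
apply: contra xs => /mapP[y ys /(seg_le mm') ->]; exact: map_f.
Qed.

(** As there are no isolated paths, the first path of a family splits off
    a new one at some higher level. *)
Lemma paths_split N n (v : vtx B n) : exists m (s : seq (ipath B)),
  [/\ size s = N.+1, forall x, x \in s -> src (x n) = v & uniq (map (seg n m) s)].
Proof.
have [_ _ /cantor_like_ipathP perf] := aB.
elim: N => [|N [m [s [sz sv us]]]].
  have [x xv] := through_vertex v; exists 0, [:: x].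
  by split=> // y; rewrite inE => /eqP ->.
case: s sz sv us => // x s sz sv us.
have [y [xy nxy]] := perf x (m + n).
have [l nel] := ipath_neq nxy.
have lmn : (m + n < l)%N by rewrite ltnNge; apply/negP => /xy.
have nl : (n <= l)%N by apply: leq_trans (ltnW lmn); exact: leq_addl.
have mm' : (m <= l - n)%N by rewrite leq_subRL// addnC ltnW.
exists (l - n), (y :: x :: s); split; first by rewrite /= -sz.
  move=> z; rewrite inE => /predU1P[->|/sv//].
  by rewrite -(xy n (leq_addl _ _)) sv// mem_head.
rewrite map_cons cons_uniq (uniq_seg_le mm' us) andbT; apply/mapP => -[z].
rewrite inE => /predU1P[-> /seg_eqP/(_ l)|zs /(seg_le mm') yz].
  by rewrite subnK// => /(_ nl (leqnn _)) /esym.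
move: us; rewrite /= => /andP[/mapP + _]; apply; exists z => //.
by rewrite -yz; apply/seg_eqP => i _ /xy.
Qed.

(** Finite paths from [v] to level [K.+1] are represented by infinite paths that
    differ up to level [K], since these can be spliced. *)
Let spread N n (v : vtx B n) K := forall w : vtx B K.+1, exists s : seq (ipath B),
  [/\ size s = N.+1, forall x, x \in s -> src (x n) = v /\ rng (x K) = w &
      exists2 m, (m + n <= K)%N & uniq (map (seg n m) s)].

Let spread_le N n (v : vtx B n) K K' : (K <= K')%N -> spread N v K -> spread N v K'.
Proof.
move=> KK' sK w; have [e /eqP ew] := rng_surj w; have [z ze] := through_edge e.
have [s [sz sv [m mK us]]] := sK (rng (z K)).
exists (map (fun x => splice K x z) s); split; first by rewrite size_map.
  move=> _ /mapP[x /sv[xv xz] ->].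
  have nK : (n <= K)%N by apply: leq_trans mK; exact: leq_addl.
  rewrite splice_le//; split=> //; move: KK'; rewrite leq_eqVlt => /predU1P[E|KK'].
    by subst K'; rewrite splice_le// xz ze.
  by rewrite splice_gt// ?ze// ipathP.
exists m; first exact: leq_trans mK KK'.
rewrite -map_comp; apply: etrans us; congr uniq; apply/eq_map => x /=.
by apply/seg_eqP => l _ lm; rewrite splice_le// (leq_trans lm).
Qed.

(** Once the paths have split, simplicity leads all of them to one and the same
    vertex of a later level. *)
Lemma spread_exists N n (v : vtx B n) : exists K, spread N v K.
Proof.
have [m [s [sz sv us]]] := paths_split N v.
have [[d con] _ _] := aB; pose j := (m + n).+1; pose a := tlevel d j.
have ma : (m + n < a)%N by exact: leq_tlevel.
exists (d j + a)%N => w.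
have /choice[z zP] (u : vtx B a) : exists z : ipath B,
    src (z a) = u /\ rng (z (d j + a)%N) = w.
  have [e [eu ew]] := con j u w; have [z' ze] := through_edge e.
  have [z zz'] := tpath_surj z'; exists z.
  by split; [rewrite -eu -ze -zz' [RHS]seg_src | rewrite -ew -ze -zz' [RHS]seg_rng].
pose b := (d (m + n) + tlevel d (m + n))%N; have mb : (m + n <= b)%N by [].
have rx x : src (z (rng (x b)) b.+1) = rng (x b) := (zP (rng (x b))).1.
exists (map (fun x => splice b x (z (rng (x b)))) s); split; first by rewrite size_map.
  move=> _ /mapP[x /sv xv ->]; rewrite splice_le; last first.
    by apply: leq_trans mb; exact: leq_addl.
  by split=> //; rewrite splice_gt ?(zP _).2//; exact: leq_addl.
exists m; first by apply: leq_trans (ltnW ma) (leq_addl _ _).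
rewrite -map_comp; apply: etrans us; congr uniq; apply/eq_map => x /=.
by apply/seg_eqP => l _ lm; rewrite splice_le// (leq_trans lm).
Qed.

Lemma many_paths N n : exists m, forall (v : vtx B n) (w : vtx B (m.+1 + n)),
  (N <= #|[pred p : Defs.fpath B n m |
            (fpath_src p == v) && (fpath_rng p == w)]|)%N.
Proof.
have /choice[K KP] := @spread_exists N n.
pose m := \max_v K v; exists m => v w.
have Km : (K v <= m + n)%N by apply: leq_trans (leq_addr _ _); exact: leq_bigmax.
have [s [sz sv [m' m'm us]]] := spread_le Km (KP v) w.
have m'lem : (m' <= m)%N by rewrite -(leq_add2r n).
apply: leq_trans (leqnSn _) _; rewrite -sz -(size_map (seg n m)) cardE.
apply: uniq_leq_size; first exact: uniq_seg_le us.
move=> _ /mapP[x /sv[xv xw] ->]; rewrite mem_enum inE seg_src xv eqxx /=.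
by rewrite seg_rng xw.
Qed.

(** The gap [d n] depends on the level reached before, which is recovered as
    [L n]. *)
Lemma multiplying_telescoping (N : nat -> nat) : exists d : nat -> nat,
  forall n (v : vtx (telescoping B d) n) (w : vtx (telescoping B d) n.+1),
  (N n <= #|edges_between v w|)%N.
Proof.
have /choice[f fP] : forall Nn : nat * nat, exists m,
    forall (v : vtx B Nn.2) (w : vtx B (m.+1 + Nn.2)),
    (Nn.1 <= #|[pred p : Defs.fpath B Nn.2 m |
                 (fpath_src p == v) && (fpath_rng p == w)]|)%N.
  by case=> M n; exact: many_paths.
pose L := fix L k := if k is k'.+1 then ((f (N k', L k')).+1 + L k')%N else 0.
pose d k := f (N k, L k); exists d => n.
have LE k : tlevel d k = L k by elim: k => //= k ->.
rewrite /edges_between /telescoping /= {1 3 4 5 6}/d.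
by move: (fP (N n, tlevel d n)); rewrite LE.
Qed.

End ManyPaths.

(** * Doubling the vertices of a diagram *)

Section Doubling.

(** Every vertex, the root excepted, receives two copies; the [b]-th copy of the
    edge [e] starts in the copy [sigma e b] of its source. *)
Variables (D : bratteli) (sigma : forall n, edge D n.+1 -> bool -> bool).
Hypothesis sigma_surj : forall n (v : vtx D n.+1) b,
  exists e b', src e = v /\ sigma e b' = b.

Definition dbl_vtx n : finType :=
  if n is n'.+1 then (vtx D n'.+1 * bool)%type : finType else vtx D 0.

Definition dbl_edge n : finType := (edge D n * bool)%type.

Definition dbl_src n : dbl_edge n -> dbl_vtx n :=
  match n with
  | 0 => fun e => src e.1
  | n'.+1 => fun e => (src e.1, sigma e.1 e.2)
  end.

Definition dbl_rng n (e : dbl_edge n) : dbl_vtx n.+1 := (rng e.1, e.2).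

Definition dbl_ele n : rel (dbl_edge n) :=
  fun e f => (e.2 == f.2) && ele e.1 f.1.

Lemma dbl_src_surj n (v : dbl_vtx n) : exists e : dbl_edge n, dbl_src e == v.
Proof.
case: n v => [|n] /= v.
  by have [e ev] := src_surj v; exists (e, false).
case: v => v b; have [e [b' [ev eb]]] := sigma_surj v b.
by exists (e, b'); rewrite /= ev eb.
Qed.

Lemma dbl_rng_surj n (v : dbl_vtx n.+1) : exists e : dbl_edge n, dbl_rng e == v.
Proof.
by case: v => v b; have [e /eqP ev] := rng_surj v; exists (e, b); rewrite /dbl_rng ev.
Qed.

Lemma dbl_ele_refl n : reflexive (@dbl_ele n).
Proof. by move=> e; rewrite /dbl_ele eqxx ele_refl. Qed.

Lemma dbl_ele_anti n : antisymmetric (@dbl_ele n).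
Proof.
move=> [e b] [f b'] /andP[/andP[/eqP /= -> ef] /andP[_ fe]]; congr pair.
by apply: ele_anti; rewrite ef.
Qed.

Lemma dbl_ele_trans n : transitive (@dbl_ele n).
Proof.
move=> f e g /andP[/eqP ef lef] /andP[/eqP fg lfg].
by rewrite /dbl_ele ef fg eqxx (ele_trans lef).
Qed.

Lemma dbl_ele_comparable n (e f : dbl_edge n) :
  dbl_ele e f || dbl_ele f e = (dbl_rng e == dbl_rng f).
Proof.
rewrite /dbl_ele /dbl_rng xpair_eqE -ele_comparable [f.2 == _]eq_sym.
by case: (e.2 == f.2); rewrite ?andbT ?andbF.
Qed.

Definition doubling : bratteli :=
  Bratteli (vtx := dbl_vtx) (vtx0 D) dbl_src_surj dbl_rng_surj dbl_ele_refl
    dbl_ele_anti dbl_ele_trans dbl_ele_comparable.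

Lemma elt_doubling n (e f : edge doubling n) :
  elt e f = (e.2 == f.2) && elt e.1 f.1.
Proof.
case: e f => [e b] [f b']; rewrite /elt /= /dbl_ele /= xpair_eqE.
by case: (b == b'); rewrite ?andbT ?andbF.
Qed.

Definition dbl_vlabel n (v : dbl_vtx n.+1) : {v : vtx D n.+1 & 'I_2} :=
  existT _ v.1 (inord v.2).

Definition dbl_elabel n (e : dbl_edge n) : {e : edge D n & 'I_2} :=
  existT _ e.1 (inord e.2).

Lemma inord_boolK : cancel (fun b : bool => inord b : 'I_2) (fun i => i == 1 :> nat).
Proof. by case; rewrite inordK. Qed.

Lemma inord_nat_boolK :
  cancel (fun i : 'I_2 => i == 1 :> nat) (fun b : bool => inord b : 'I_2).
Proof. by case=> -[|[|//]] lt; apply/val_inj; rewrite /= inordK. Qed.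

Lemma dbl_vlabel_bij n : bijective (@dbl_vlabel n).
Proof.
exists (fun u : {v : vtx D n.+1 & 'I_2} => (tag u, tagged u == 1 :> nat)).
  by case=> v b; rewrite /= inord_boolK.
by case=> v i; rewrite /dbl_vlabel /= inord_nat_boolK.
Qed.

Lemma dbl_elabel_bij n : bijective (@dbl_elabel n).
Proof.
exists (fun u : {e : edge D n & 'I_2} => (tag u, tagged u == 1 :> nat)).
  by case=> e b; rewrite /= inord_boolK.
by case=> e i; rewrite /dbl_elabel /= inord_nat_boolK.
Qed.

Lemma dbl_elabel_lt n (e f : edge doubling n) :
  elt e f = (tagged (dbl_elabel e) == tagged (dbl_elabel f) :> nat) &&
            elt (tag (dbl_elabel e)) (tag (dbl_elabel f)).
Proof.
rewrite elt_doubling /=; congr (_ && _).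
by rewrite !inordK; [case: e.2; case: f.2|case: f.2|case: e.2].
Qed.

Definition doubling_copy : copy_pasting D doubling :=
  CopyPasting (copies := fun n (_ : vtx D n.+1) => 2)
    (vlabel := @dbl_vlabel : forall n, vtx doubling n.+1 -> _)
    (elabel := @dbl_elabel : forall n, edge doubling n -> _)
    dbl_vlabel_bij dbl_elabel_bij
    (fun n e => erefl) (fun n e => erefl) dbl_elabel_lt.

Local Notation p := (collapse doubling_copy).
Implicit Types (a b : ipath D) (x y : ipath doubling).

Lemma collapseE x n : p x n = (x n).1. Proof. by []. Qed.

Lemma fibre_edge x y n : p x = p y -> (x n).1 = (y n).1.
Proof. by move=> pxy; exact: (congr1 (fun a : ipath D => a n) pxy). Qed.

Lemma label_step x n : (x n).2 = sigma (x n.+1).1 (x n.+1).2.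
Proof. by have := congr1 snd (ipathP x n). Qed.

Lemma labelled_subproof a (j : nat -> bool) :
  (forall n, j n = sigma (a n.+1) (j n.+1)) ->
  forall n, src ((a n.+1, j n.+1) : edge doubling n.+1) =
            rng ((a n, j n) : edge doubling n).
Proof. by move=> ja n; rewrite /= /dbl_rng /= ipathP -ja. Qed.

Definition labelled a j (ja : forall n, j n = sigma (a n.+1) (j n.+1)) : ipath doubling :=
  IPath (edge_at := fun n => (a n, j n) : edge doubling n) (labelled_subproof ja).

Lemma collapse_labelled a j ja : p (@labelled a j ja) = a.
Proof. exact: ipath_ext. Qed.

(** The label of a level determines those of the lower levels through [sigma]. *)
Lemma fibre_label x y m : p x = p y -> (x m).2 = (y m).2 ->
  forall i, (i <= m)%N -> (x i).2 = (y i).2.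
Proof.
move=> pxy; elim: m => [|m IHm] lab i; first by rewrite leqn0 => /eqP ->.
rewrite leq_eqVlt => /predU1P[->//|]; rewrite ltnS; apply: IHm.
by rewrite (label_step x) (label_step y) lab (fibre_edge m.+1 pxy).
Qed.

Lemma fibre_eq x y : p x = p y -> (forall n, (x n).2 = (y n).2) -> x = y.
Proof.
move=> pxy lab; apply: ipath_ext => n; rewrite [LHS]surjective_pairing.
by rewrite [RHS]surjective_pairing lab (fibre_edge n pxy).
Qed.

Lemma fibre_neq x y : p x = p y -> x <> y ->
  exists N, forall n, (N <= n)%N -> (x n).2 != (y n).2.
Proof.
move=> pxy nxy; have [N nN] : exists N, (x N).2 <> (y N).2.
  by apply: contrapT => h; apply: nxy; apply: fibre_eq => // n;
    apply: contrapT => h'; apply: h; exists n.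
by exists N => n Nn; apply/eqP => lab; apply: nN; apply: fibre_label pxy lab _ Nn.
Qed.

(** A fibre is an inverse limit of sets with two elements. *)
Lemma doubling_fibres_le2 : fibres_le2 p.
Proof.
move=> a; set F := _ @^-1` _.
suff [x1 [x2 sF]] : exists x1 x2, F `<=` [set x1; x2].
  apply: card_le_trans (subset_card_le sF) _.
  have -> : [set x1; x2] = (fun i => if i == 0 then x1 else x2) @` `I_2.
    apply/seteqP; split=> [x [->|->]|_ [i _ <-]]; first by exists 0.
      by exists 1.
    by case: ifP; [left|right].
  exact: card_image_le.
have [[x1 [x2 [Fx1 Fx2 n12]]]|none] :=
    pselect (exists x1 x2, [/\ F x1, F x2 & x1 <> x2]).
  exists x1, x2 => x Fx; apply: contrapT => /not_orP[n1 n2].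
  have eqp u v : F u -> F v -> p u = p v by move=> -> ->.
  have [N h] := fibre_neq (eqp _ _ Fx1 Fx2) n12.
  have [N1 h1] := fibre_neq (eqp _ _ Fx Fx1) n1.
  have [N2 h2] := fibre_neq (eqp _ _ Fx Fx2) n2.
  move: (h (N + (N1 + N2))%N) (h1 (N + (N1 + N2))%N) (h2 (N + (N1 + N2))%N).
  rewrite leq_addr => /(_ isT) + /(_ _) + /(_ _).
  case: (x1 _).2; case: (x2 _).2; case: (x _).2 => //= _ m1 m2.
  - by have := m1 (leq_trans (leq_addr _ _) (leq_addl _ _)).
  - by have := m2 (leq_trans (leq_addl _ _) (leq_addl _ _)).
  - by have := m2 (leq_trans (leq_addl _ _) (leq_addl _ _)).
  - by have := m1 (leq_trans (leq_addr _ _) (leq_addl _ _)).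
have [[x Fx]|nF] := pselect (exists x, F x); last first.
  by exists point, point => x Fx; case: nF; exists x.
exists x, x => y Fy; left; apply: contrapT => nxy; apply: none.
by exists y, x.
Qed.

Lemma doubling_continuous : continuous p.
Proof.
move=> x A /nbhs_ipathP[n xA]; apply/nbhs_ipathP; exists n => y xy.
by apply: xA => i ni; rewrite !collapseE xy.
Qed.

Lemma top_doubling n (e : edge doubling n) : top_edge e = top_edge e.1.
Proof.
apply/forallP/forallP => h f.
  by have := h (f, e.2); rewrite elt_doubling /= eqxx.
by rewrite elt_doubling negb_and h orbT.
Qed.

Lemma bot_doubling n (e : edge doubling n) : bot_edge e = bot_edge e.1.
Proof.
apply/forallP/forallP => h f.
  by have := h (f, e.2); rewrite elt_doubling /= eqxx.
by rewrite elt_doubling negb_and h orbT.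
Qed.

Lemma collapse_maximal x : maximal_path x <-> maximal_path (p x).
Proof.
by rewrite !maximal_pathP; split=> h n; have := h n; rewrite top_doubling collapseE.
Qed.

Lemma collapse_minimal x : minimal_path x <-> minimal_path (p x).
Proof.
by rewrite !minimal_pathP; split=> h n; have := h n; rewrite bot_doubling collapseE.
Qed.

Lemma collapse_vstep l x y : vstep l x y -> vstep l (p x) (p y).
Proof.
case=> ext cov tl; split=> [i /ext[]||m /tl xy]; last by rewrite !collapseE xy.
  by rewrite top_doubling bot_doubling !collapseE.
have [] := edge_coverP cov; rewrite elt_doubling => /andP[/eqP lab lt] no.
rewrite /edge_cover !collapseE lt; apply/forallP => z; apply/negP => /andP[xz zy].
apply: (no (z, (x l).2)); rewrite elt_doubling /=; first by rewrite eqxx.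
by rewrite lab eqxx.
Qed.

Lemma collapse_lt x y : ipath_lt x y -> ipath_lt (p x) (p y).
Proof.
move=> [n [lt tl]]; exists n; split=> [|m /tl xy]; last by rewrite !collapseE xy.
by move: lt; rewrite elt_doubling => /andP[].
Qed.

Lemma collapse_vershik : properly_ordered D -> properly_ordered doubling ->
  forall x, p (vershik x) = vershik (p x).
Proof.
move=> poD po x; symmetry; have [maxx|nmax] := pselect (maximal_path x).
  apply: (vershik_max poD); first exact/collapse_maximal.
  by apply/collapse_minimal; exact: (vershikP po x).1.
have [l st] := successor_vstep ((vershikP po x).2 nmax).
exact: (vershik_successor poD (vstep_successor (collapse_vstep st))).
Qed.

Lemma lift_lt N x y : (forall m, (N <= m)%N -> x m = y m) ->
  ipath_lt (p x) (p y) -> ipath_lt x y.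
Proof.
move=> tl lt; have [E|//|/collapse_lt lt'] := ipath_lt_total tl.
  by move: lt; rewrite E => /ipath_lt_irr.
by have /ipath_lt_irr := ipath_lt_trans lt lt'.
Qed.

(** On the way to its target, an orbit stays strictly below it, and collapsing
    preserves strict inequalities: so neither orbit can arrive over the common
    image of the targets before the other. *)
Lemma simultaneous_reach N x y x' y' :
  properly_ordered D -> properly_ordered doubling ->
  p x = p y -> p x' = p y' -> ipath_lt (p x) (p x') ->
  (forall m, (N <= m)%N -> x m = x' m) -> (forall m, (N <= m)%N -> y m = y' m) ->
  exists i, iter i (@vershik doubling) x = x' /\ iter i (@vershik doubling) y = y'.
Proof.
move=> poD po pxy pxy' lt tlx tly.
have conj u i : p (iter i (@vershik doubling) u) = iter i (@vershik D) (p u).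
  by elim: i => //= i <-; exact: collapse_vershik.
have [i [ix li]] := vershik_reach po tlx (lift_lt tlx lt).
have lty : ipath_lt (p y) (p y') by rewrite -pxy -pxy'.
have [k [ky lk]] := vershik_reach po tly (lift_lt tly lty).
suff E : i = k by exists i; split=> //; rewrite E.
case: (ltngtP i k) => // ik.
  have [/collapse_lt + _] := lk i ik.
  by rewrite conj -pxy -conj ix pxy' => /ipath_lt_irr.
have [/collapse_lt + _] := li k ik.
by rewrite conj pxy -conj ky pxy' => /ipath_lt_irr.
Qed.

(** A labelling of a path is determined downwards by its tail. *)
Lemma lift_of_tail a N (j : nat -> bool) :
  (forall n, (N <= n)%N -> j n = sigma (a n.+1) (j n.+1)) ->
  exists x, p x = a /\ forall n, (N <= n)%N -> (x n).2 = j n.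
Proof.
elim: N j => [|N IHN] j ja.
  exists (@labelled a j (fun n => ja n isT)); split=> //; exact: collapse_labelled.
pose j' n := if n == N then sigma (a N.+1) (j N.+1) else j n.
have neq k (Nk : (N < k)%N) : (k == N) = false := gtn_eqF Nk.
have [n|x [xa xj]] := IHN j'.
  rewrite leq_eqVlt /j' => /predU1P[<-|Nn]; first by rewrite eqxx neq.
  by rewrite (neq n)// (neq n.+1) 1?ltnW// ja.
by exists x; split=> // n Nn; rewrite xj 1?ltnW// /j' neq.
Qed.

End Doubling.

(** * The twisted double *)

Definition parallel_core (D : bratteli) n (v : vtx D n) (w : vtx D n.+1) :=
  [pred e : edge D n | [&& src e == v, rng e == w & ~~ ext_edge e]].

(** In each class of parallel edges one nonextremal edge, if there is any, is
    chosen to exchange the copies of its source, the others preserving them. *)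
Definition crossing (D : bratteli) n (e : edge D n) : bool :=
  [pick f in parallel_core (src e) (rng e)] == Some e.

(** Extremal edges merge the two copies, which makes the extremal paths unique;
    all other edges act bijectively on labels, which keeps generic fibres at two
    points. *)
Definition twist (D : bratteli) n (e : edge D n.+1) (b : bool) : bool :=
  if ext_edge e then false else crossing e (+) b.

Lemma crossing_values (D : bratteli) n (v : vtx D n) (w : vtx D n.+1) b :
  (4 <= #|edges_between v w|)%N ->
  exists e, [/\ src e = v, rng e = w, ~~ ext_edge e & crossing e = b].
Proof.
move=> par; have card2 : (1 < #|parallel_core v w|)%N.
  rewrite -(leq_add2l 2); apply: leq_trans par _.
  rewrite -(cardID (@ext_edge D n)) leq_add//.
    apply: leq_trans (card_ext_edge w); apply/subset_leq_card/fintype.subsetP => e.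
    by rewrite !inE => /andP[/andP[_ ->] ex]; rewrite andbT; exact: ex.
  apply/subset_leq_card/fintype.subsetP => e.
  by rewrite !inE => /andP[next /andP[-> ->]]; exact: next.
have pickE e : e \in parallel_core v w ->
    crossing e = ([pick f in parallel_core v w] == Some e).
  by rewrite /crossing inE => /and3P[/eqP -> /eqP -> _].
have /card_gt1P[e1 [e2 [e1P e2P n12]]] := card2.
case: pickP pickE => [f fP|/(_ e1)]; last by rewrite e1P.
move=> pickE; have : exists e, e \in parallel_core v w /\ crossing e = b.
  case: b; first by exists f; rewrite pickE// eqxx.
  have [E|nf] := eqVneq f e1.
    by exists e2; rewrite pickE// E; split=> //; apply: negbTE.
  by exists e1; rewrite pickE//; split=> //; apply: negbTE.
by move=> [e []]; rewrite inE => /and3P[/eqP ? /eqP ? ?] ?; exists e.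
Qed.

Section TwistedDouble.
Variables (D : bratteli) (aD : admissible D).
Hypothesis par : forall n (v : vtx D n) (w : vtx D n.+1),
  (2 ^ n.+2 <= #|edges_between v w|)%N.

Let par4 n (v : vtx D n) (w : vtx D n.+1) :
  (4 <= #|edges_between v w|)%N.
Proof. by apply: leq_trans (par v w); rewrite (@leq_exp2l 2 2). Qed.

Let poD : properly_ordered D. Proof. by case: aD. Qed.

Lemma twist_surj n (v : vtx D n.+1) b :
  exists (e : edge D n.+1) b', src e = v /\ twist e b' = b.
Proof.
have [w _] : exists w : vtx D n.+2, true.
  by have [e _] := src_surj v; exists (rng e).
have [e [ev _ next _]] := crossing_values false (par4 v w).
exists e, (crossing e (+) b); split=> //.
by rewrite /twist (negbTE next) addbA addbb.
Qed.

Definition twisted_double : bratteli := doubling twist_surj.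
Local Notation T := twisted_double.

Definition twisted_copy : copy_pasting D T := doubling_copy twist_surj.
Local Notation p := (collapse twisted_copy).
Implicit Types (a : ipath D) (x y : ipath T).

(** A crossing and a noncrossing edge reach both copies of the source, from
    either copy of the target. *)
Lemma twisted_connected n (v : vtx T n) (w : vtx T n.+1) :
  exists e : edge T n, src e = v /\ rng e = w.
Proof.
case: w => w j; case: n v w => [|n] v w.
  have [e [ev ew _ _]] := crossing_values false (par4 (v : vtx D 0) w).
  by exists (e, j); rewrite /= /dbl_rng ev ew.
case: v => v i; have [e [ev ew next ce]] := crossing_values (i (+) j) (par4 v w).
exists (e, j); rewrite /= /dbl_rng /= ev ew /twist (negbTE next) ce.
by rewrite -addbA addbb addbF.
Qed.

Lemma label_ext x n : ext_edge (x n.+1).1 -> (x n).2 = false.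
Proof. by move=> ext; rewrite (@label_step D (@twist D)) /twist ext. Qed.

Lemma label_next x n :
  ~~ ext_edge (x n.+1).1 -> (x n).2 = crossing (x n.+1).1 (+) (x n.+1).2.
Proof. by move=> /negbTE next; rewrite (@label_step D (@twist D)) /twist next. Qed.

Lemma extremal_fibre a : (forall n, ext_edge (a n)) ->
  exists x, [/\ p x = a & forall y, p y = a -> y = x].
Proof.
move=> ext; have ja n : false = twist (a n.+1) false by rewrite /twist ext.
exists (@labelled D (@twist D) twist_surj a (fun=> false) ja); split.
  exact: collapse_labelled.
move=> y ya; apply: (@fibre_eq D (@twist D) twist_surj).
  by rewrite [LHS]ya; exact/esym/collapse_labelled.
by move=> n; rewrite label_ext// -[(y n.+1).1]/(p y n.+1) ya.
Qed.

Lemma twisted_properly_ordered : properly_ordered T.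
Proof.
have [[M [maxM uM]] [m [minm um]]] := poD; split.
  have /maximal_pathP topM := maxM.
  have [|x [xM ux]] := @extremal_fibre M; first by move=> n; rewrite /ext_edge topM.
  exists x; split=> [|y /collapse_maximal/uM yM]; last exact/esym/ux/esym.
  by apply/collapse_maximal; rewrite [collapse _ _]xM.
have /minimal_pathP botm := minm.
have [|x [xm ux]] := @extremal_fibre m; first by move=> n; rewrite /ext_edge botm orbT.
exists x; split=> [|y /collapse_minimal/um ym]; last exact/esym/ux/esym.
by apply/collapse_minimal; rewrite [collapse _ _]xm.
Qed.

(** A path can be continued into both copies of a vertex two levels higher. *)
Lemma twisted_cantor_like : cantor_like (ipath T).
Proof.
apply/cantor_like_ipathP => x n; have [e _] := rng_surj (rng (x n)).
have [w _] : exists w : vtx D n.+2, true by exists (rng (p x n.+1)).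
have branch b : exists y, same_head n x y /\ (y n.+1).2 = b.
  have [f [fs fr]] := twisted_connected (rng (x n)) ((w, b) : vtx T n.+2).
  have [z zf] := through_edge f; exists (splice n x z); split.
    by move=> i ni; rewrite splice_le.
  by rewrite splice_gt// ?zf//; case: fr.
have [y [xy yb]] := branch (~~ (x n.+1).2); exists y; split=> // E.
by move: yb; rewrite -E; case: (x n.+1).2.
Qed.

Lemma twisted_admissible : admissible T.
Proof.
split; first exact: connected_simple twisted_connected.
  exact: twisted_properly_ordered.
exact: twisted_cantor_like.
Qed.

Lemma twisted_almost_one_to_one : almost_one_to_one p.
Proof.
have [[M [/maximal_pathP topM _]] _] := poD.
have [|x [xM ux]] := @extremal_fibre M; first by move=> n; rewrite /ext_edge topM.
exists M, x; apply/seteqP; split=> y; [exact: ux|by move->].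
Qed.

(** If only finitely many edges of [a] are extremal, then the maps between
    labels are eventually bijections, and a label may be prescribed. *)
Lemma eventually_next_fibre a N b : (forall n, (N <= n)%N -> ~~ ext_edge (a n.+1)) ->
  exists x, p x = a /\ (x N).2 = b.
Proof.
move=> next; pose S := fix S n := if n is n'.+1 then crossing (a n) (+) S n' else false.
have [n Nn|x [xa xj]] := @lift_of_tail D (@twist D) twist_surj a N
    (fun n => b (+) S N (+) S n).
  rewrite /twist (negbTE (next n Nn)) /= -/(S n).
  by case: (crossing _); case: b; case: (S N); case: (S n).
by exists x; split=> //; rewrite xj// -addbA addbb addbF.
Qed.

(** If infinitely many edges of [a] are extremal, then the label of a level
    is read off from any sufficiently long segment of [a]. *)
Lemma frequently_ext_fibre a : (forall n, exists i, ext_edge (a (n + i).+1)) ->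
  exists x, p x = a.
Proof.
move=> /choice[i iP].
pose down := fix down n k : bool :=
  if k is k'.+1 then twist (a n.+1) (down n.+1 k') else false.
have stable n l k k' : ext_edge (a (n + l).+1) -> (l < k)%N -> (k <= k')%N ->
    down n k = down n k'.
  elim: l n k k' => [|l IHl] n [//|k] [//|k'] ext /=.
    by rewrite addn0 in ext; rewrite /twist ext.
  rewrite !ltnS => lk kk'; congr twist; apply: IHl => //.
  by rewrite addSnnS.
pose j n := down n (i n).+1.
have ja n : j n = twist (a n.+1) (j n.+1).
  rewrite /j -[RHS]/(down n (i n.+1).+2).
  pose K := maxn (i n).+1 (i n.+1).+2.
  rewrite (stable n (i n) _ K)//; last exact: leq_maxl.
  rewrite [RHS](stable n (i n.+1).+1 _ K)//; last exact: leq_maxr.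
  by rewrite addnS -addSn.
exists (@labelled D (@twist D) twist_surj a j ja); exact: collapse_labelled.
Qed.

Lemma twisted_surjective a : exists x, p x = a.
Proof.
have [h|h] := pselect (forall n, exists i, ext_edge (a (n + i).+1)).
  exact: frequently_ext_fibre.
have [N nN] : exists N, ~ exists i, ext_edge (a (N + i).+1).
  by apply: contrapT => h'; apply: h => n; apply: contrapT => h''; apply: h'; exists n.
have [|x [xa _]] := @eventually_next_fibre a N false; last by exists x.
by move=> n Nn; apply/negP => ext; apply: nN; exists (n - N); rewrite subnKC.
Qed.

Lemma twisted_factor_map : factor_map p.
Proof.
split; first exact: doubling_continuous.
  exact: twisted_surjective.
exact: collapse_vershik poD twisted_properly_ordered.
Qed.

(** A regular fibre lies over a path with infinitely many extremal edges, and
    almost every path has only finitely many. *)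
Lemma twisted_irregular (R : realType) : irregular p R.
Proof.
move=> mu invmu; exists (lim_sup_set (fun n => [set a : borel_ipath D | ext_edge (a n)])).
split.
- apply: bigcap_measurable => // k _; apply: bigcup_measurable => n _.
  have -> : [set a : borel_ipath D | ext_edge (a n)] =
      \bigcup_(e in [set e | ext_edge e]) [set a : borel_ipath D | a n = e].
    apply/seteqP; split=> a /=; last by move=> [e Pe ->].
    by move=> Pa; exists (a n).
  apply: fin_bigcup_measurable => [|e _]; first exact: finite_finset.
  exact: measurable_edge.
- exact: ext_edges_null.
- move=> a [x fx] N _; apply: contrapT => nN.
  have next n : (N <= n)%N -> ~~ ext_edge (a n.+1).
    by move=> Nn; apply/negP => ext; apply: nN; exists n.+1 => //=; rewrite leqW.
  have lab (b : bool) : (x N).2 = b.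
    have [y [ya <-]] := eventually_next_fibre b next.
    have : (p @^-1` [set a]) y by [].
    by rewrite fx => ->.
  by have := lab true; rewrite (lab false).
Qed.

Lemma label_neq_root x y N : p x = p y ->
  (forall n, (n <= N)%N -> ~~ ext_edge (p x n)) -> (x N).2 != (y N).2 ->
  x 0 <> y 0.
Proof.
move=> pxy next nlab E; have {E} : (x 0).2 = (y 0).2 by rewrite E.
apply/eqP; elim: N next nlab => // N IHN next nlab; apply: IHN.
  by move=> n nN; apply: next; rewrite leqW.
have nx : ~~ ext_edge (x N.+1).1 by exact: next.
have E1 : (x N.+1).1 = (y N.+1).1 by rewrite -[LHS]/(p x N.+1) pxy.
rewrite (label_next nx) (label_next (_ : ~~ ext_edge (y N.+1).1)) -?E1//.
by rewrite (inj_eq (@addbI _)).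
Qed.

(** Two points of a fibre differ in the labels of all levels from some [N]
    on. Powers of the Vershik map take them simultaneously to paths whose
    edges up to level [N] are not extremal; there the difference is transported
    down to the root. *)
Lemma twisted_k_expansive k : k_expansive k D -> k_expansive k T.
Proof.
move=> kD x y nxy; have po := twisted_properly_ordered.
have [_ _ pv] := twisted_factor_map.
have [pxy|npxy] := pselect (p x = p y); last first.
  have [n nh] := kD _ _ npxy; exists n => h; apply: nh.
  rewrite -!(vershik_iter_conj po poD pv) => i ik.
  by rewrite /= h.
have [N lab] := fibre_neq pxy nxy; pose a := p x.
have sel n (w : vtx D n.+1) : exists2 e, rng e = w & ~~ ext_edge e.
  have [z _] := through_vertex w; have [e0 _] := rng_surj w.
  by have [e [_ ew next _]] := crossing_values false (par4 (src e0) w); exists e.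
have [e er enext] := sel N (rng (a N)).
have [||b [bN btl bnext]] := graft sel (n := N) (e := e) (t := a).
- by move=> m _; exact: ipathP.
- by rewrite ipathP er.
have {}bnext n : (n <= N)%N -> ~~ ext_edge (b n).
  by rewrite leq_eqVlt => /predU1P[->|/bnext//]; rewrite bN.
have lifted u : p u = a ->
    exists u', p u' = b /\ forall n, (N <= n)%N -> (u' n).2 = (u n).2.
  move=> ua; apply: (@lift_of_tail D (@twist D) twist_surj b N (fun n => (u n).2)).
  by move=> n Nn; rewrite btl// -ua; exact: label_step.
have [x' [x'b xl]] := lifted x erefl; have [y' [y'b yl]] := lifted y (esym pxy).
have tail u u' : p u = a -> p u' = b -> (forall n, (N <= n)%N -> (u' n).2 = (u n).2) ->
    forall m, (N.+1 <= m)%N -> u m = u' m.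
  move=> ua ub lu m Nm; rewrite [LHS]surjective_pairing [RHS]surjective_pairing.
  by rewrite lu 1?ltnW// -[(u m).1]/(p u m) -[(u' m).1]/(p u' m) ua ub btl.
have pxy' : p x' = p y' by rewrite x'b y'b.
have root : x' 0 <> y' 0.
  apply: (@label_neq_root x' y' N pxy'); first by rewrite x'b.
  by rewrite xl// yl// lab.
have tx := tail x x' erefl x'b xl; have ty := tail y y' (esym pxy) y'b yl.
have [E|lt|lt] := @ipath_lt_total D N.+1 a b (fun m Nm => esym (btl m Nm)).
- exists 0 => /(_ 0 (leq0n _)) /= h; apply: root.
  suff eqv u u' : p u = a -> p u' = b -> (forall n, (N <= n)%N -> (u' n).2 = (u n).2) ->
      u = u'.
    by rewrite -(eqv x x')// -(eqv y y')// -pxy.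
  move=> ua ub lu; have puu' : p u = p u' by rewrite ua ub.
  apply: (fibre_eq puu') => n; have [Nn|/ltnW nN] := leqP N n; first by rewrite lu.
  by apply: fibre_label puu' (esym (lu N (leqnn N))) _ nN.
- have lt' : ipath_lt (p x) (p x') by rewrite x'b.
  have [i [ix iy]] := simultaneous_reach poD po pxy pxy' lt' tx ty.
  by exists (Posz i) => /(_ 0 (leq0n _)) /=; rewrite ix iy.
- have lt' : ipath_lt (p x') (p x) by rewrite x'b.
  have [[|i] [ix iy]] := simultaneous_reach poD po pxy' pxy lt'
    (fun m Nm => esym (tx m Nm)) (fun m Nm => esym (ty m Nm)).
    by exists 0 => /(_ 0 (leq0n _)) /=; rewrite -ix -iy.
  exists (Negz i) => /(_ 0 (leq0n _)).
  by rewrite /vershik_iter -ix -iy !iter_vershikK.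
Qed.

End TwistedDouble.

Theorem theorem3p10 (R : realType) (B : bratteli) (hB : admissible B) :
  exists d : nat -> nat,
    let B' := telescoping B d in
    let good (Bh : bratteli) (p : ipath Bh -> ipath B') :=
      extension_triple p /\
      [/\ factor_map p, almost_one_to_one p, irregular p R & fibres_le2 p] in
    (exists (Bh : bratteli) (p : ipath Bh -> ipath B'), good Bh p) /\
    (forall k : nat, k_expansive k B ->
      exists (Bh : bratteli) (p : ipath Bh -> ipath B'),
        good Bh p /\ k_expansive k Bh).
Proof.
have [d par] := multiplying_telescoping hB (fun n => 2 ^ n.+2)%N.
exists d => B' good; have [_ poB cB] := hB.
have aB' : admissible B'.
  split; last exact: tpath_cantor_like.
    apply: connected_simple => n v w.
    have /card_gt0P[e] : (0 < #|edges_between v w|)%N.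
      by apply: leq_trans (par n v w); rewrite expn_gt0.
    by rewrite inE => /andP[/eqP ev /eqP ew]; exists e.
  exact: tpath_properly_ordered.
have goodT : good (twisted_double par) (collapse (twisted_copy par)).
  split; first by split=> //; [exact: twisted_admissible|exists (twisted_copy par)].
  split; first exact: twisted_factor_map.
  - exact: twisted_almost_one_to_one.
  - exact: twisted_irregular.
  - exact: doubling_fibres_le2.
split; first by exists (twisted_double par), (collapse (twisted_copy par)).
move=> k kB; exists (twisted_double par), (collapse (twisted_copy par)).
split=> //; apply: (twisted_k_expansive aB'); exact: tpath_k_expansive.
Qed.
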